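(* Let $\phi$ be a flow on $X$. Lyapunov function compactifications for the flow $\phi$ exist. Let $\hat\phi$ on $\hat X$ be such a Lyapunov function compactification for $\phi$. Then: (a) $\hat X$ is a dynamic compactification for $\phi$, with $(X\times X)\cap\mathcal G\hat\phi=\mathcal G\phi$ and $(X\times X)\cap\mathcal G(\hat\phi^J)=\mathcal G(\phi^J)$. (b) The compact set $\hat X\setminus X$ is $\hat\phi$ invariant, and every generalized recurrent point of $\hat\phi$ which lies in $\hat X\setminus X$ is a fixed point for $\hat\phi$; that is, $(\hat X\setminus X)\cap|\mathcal G(\hat\phi^J)|\subset|\hat\phi|$. (c) If $\hat E\subset|\mathcal G(\hat\phi^J)|$ is a $\mathcal G(\hat\phi^J)\cap\mathcal G(\hat\phi^J)^{-1}$ equivalence class and $E=\hat E\cap X$, then exactly one of the following three possibilities holds: (i) $\hat E$ consists of a single point of $\hat X\setminus X$ which is a fixed point for $\hat\phi$, and $E=\emptyset$. (ii) $\hat E$ is the one point compactification of a noncompact $\mathcal G(\phi^J)\cap\mathcal G(\phi^J)^{-1}$ equivalence class $E$; that is, there is a noncompact $\mathcal G(\phi^J)\cap\mathcal G(\phi^J)^{-1}$ equivalence class $E\subset X$ whose closure is $\hat E$, and $\hat E\setminus E$ is a singleton which is a fixed point of $\hat\phi$. (iii) $\hat E$ is contained in $X$, i.e. $\hat E=E$, and it is a compact $\mathcal G(\phi^J)\cap\mathcal G(\phi^J)^{-1}$ equivalence class. (d) For $x\in X$, the $\mathcal G\hat\phi\cap\mathcal G\hat\phi^{-1}$ equivalence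 class of $x$ is the closure in $\hat X$ of its $\mathcal G\phi\cap\mathcal G\phi^{-1}$ equivalence class. (e) If $X$ is metrizable then there exist metrizable Lyapunov function compactifications for $\phi$.
   Context: A space is a locally compact, $\sigma$-compact Hausdorff space; $X$ is a space. For a relation $g\subset X\times X$: $g^{-1}=\{(y,x):(x,y)\in g\}$, $|g|=\{x:(x,x)\in g\}$. For a closed relation $g$, $\mathcal Gg$ is the smallest closed transitive relation containing $g$; $\mathcal Gg\cap(\mathcal Gg)^{-1}$ restricts to an equivalence relation on $|\mathcal Gg|$, whose classes are the $\mathcal Gg\cap\mathcal Gg^{-1}$ equivalence classes. A flow $\phi:\mathbb R\times X\to X$ is a continuous action of $\mathbb R$; $\phi^t(x)=\phi(t,x)$. For compact $K\subset\mathbb R$, $\phi^K=\bigcup_{t\in K}\phi^t$, a closed relation (each map $\phi^t$ being identified with its graph). $I=[0,1]$, $J=[1,2]$. $\mathcal G\phi=\mathcal G(\phi^I)$ (which is reflexive), $\mathcal G\phi^{-1}=(\mathcal G\phi)^{-1}$; points of $|\mathcal G(\phi^J)|$ are the generalized recurrent points of $\phi$. $|\phi|$ is the set of fixed points $\{x:\phi^t(x)=x\ \text{for all }t\ge0\}$. $\mathcal B(X)$ is the Banach algebra of bounded continuous real functions on $X$ with the sup norm; $\mathcal B_\phi(X)$ is the closed subalgebra of those $u$ for which $t\mapsto u\circ\phi^t$ is a uniformly continuous function from $\mathbb R$ to $\mathcal B(X)$. A proper compactification of $X$ is a compact Hausdorff space $\hat X$ containing $X$ as a dense (hence open) topological subspace;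 it corresponds to the closed subalgebra $\mathcal A\subset\mathcal B(X)$ of functions which extend continuously to $\hat X$, and conversely every closed subalgebra $\mathcal A$ (containing the constants) distinguishing points from closed sets is associated with such a compactification, unique up to homeomorphism. A compactification for the flow $\phi$ is a proper compactification whose algebra $\mathcal A$ satisfies $\mathcal A\subset\mathcal B_\phi(X)$ and $\{u\circ\phi^t:u\in\mathcal A\}=\mathcal A$ for all $t\in\mathbb R$; then $\phi$ extends uniquely to a flow $\hat\phi$ on $\hat X$. It is dynamic for $\phi$ if $(X\times X)\cap\mathcal G(\hat\phi^J)=\mathcal G(\phi^J)$. A Lyapunov function for the flow is $L\in\mathcal B(X)$ such that $t\mapsto L(\phi(t,x))$ is nondecreasing for every $x$. With $\le_L=\{(x,y):L(x)\le L(y)\}$, a set $\mathcal L$ of Lyapunov functions for the flow is sufficient if $\mathcal L\subset\mathcal B_\phi(X)$ and $\bigcap_{L\in\mathcal L}\le_L=\mathcal G\phi$. A Lyapunov function compactification for the flow is the compactification associated with the closed subalgebra generated by $\mathcal L$ and the continuous functions of compact support, where $\mathcal L$ is a sufficient set of Lyapunov functions for the flow which is $\phi^*$ invariant (i.e. $\{L\circ\phi^t:L\in\mathcal L\}=\mathcal L$ for all $t$). *)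

(* Defs.v *)
From HB Require Import structures.
From mathcomp Require Import all_boot all_order all_algebra.
From mathcomp Require Import all_classical all_reals.
From mathcomp Require Import topology normedtype.

Set Implicit Arguments.
Unset Strict Implicit.
Unset Printing Implicit Defensive.

Import Order.TTheory GRing.Theory Num.Theory.
Import numFieldNormedType.Exports.

Local Open Scope classical_set_scope.
Local Open Scope ring_scope.

Definition exactly_one_of_three (P Q R : Prop) : Prop :=
  [\/ [/\ P, ~ Q & ~ R], [/\ ~ P, Q & ~ R] | [/\ ~ P, ~ Q & R]].

(** * Topological spaces *)

Definition sigma_compact (T : topologicalType) : Prop :=
  exists2 K : nat -> set T, (forall n, compact (K n)) & \bigcup_n K n = setT.

Definition lcsc_hausdorff (T : topologicalType) : Prop :=
  [/\ locally_compact [set: T], sigma_compact T & hausdorff_space T].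

Definition metrizable (R : realType) (T : topologicalType) : Prop :=
  exists (M : metricType R) (f : T -> M) (g : M -> T),
    [/\ continuous f, continuous g, cancel f g & cancel g f].

Definition topological_embedding (S T : topologicalType) (i : S -> T) : Prop :=
  injective i /\ forall U : set S, open U <-> exists2 V, open V & U = i @^-1` V.

(** * Relations *)

Section Relations.
Context {T : Type}.
Implicit Types (g : set (T * T)) (E : set T).

Definition rel_transitive g : Prop :=
  forall x y z, g (x, y) -> g (y, z) -> g (x, z).

Definition rel_inv g : set (T * T) := [set xy | g (xy.2, xy.1)].

Definition rel_diag g : set T := [set x | g (x, x)].

Definition rel_class g (x : T) : set T := [set y | (g `&` rel_inv g) (x, y)].

Definition is_rel_class g E : Prop := exists2 x, rel_diag g x & E = rel_class g x.

(* The trace on [S] of a relation on [T], for [S] embedded in [T] by [i]. *)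
Definition rel_trace (S : Type) (i : S -> T) g : set (S * S) :=
  [set xy | g (i xy.1, i xy.2)].

End Relations.

(* The relation written with a calligraphic G *)
Definition chain_closure (T : topologicalType) (g : set (T * T)) : set (T * T) :=
  smallest [set h | closed h /\ rel_transitive h] g.

(** * Flows *)

Section Flows.
Context {R : realType} {X : topologicalType}.
Implicit Type phi : R -> X -> X.

Definition is_flow phi : Prop :=
  [/\ continuous (fun tx : R * X => phi tx.1 tx.2),
      forall x, phi 0 x = x
    & forall s t x, phi (s + t) x = phi s (phi t x)].

Definition flow_rel phi (K : set R) : set (X * X) :=
  [set xy | exists2 t, K t & xy.2 = phi t xy.1].

Definition GI phi : set (X * X) := chain_closure (flow_rel phi `[0, 1]).

Definition GJ phi : set (X * X) := chain_closure (flow_rel phi `[1, 2]).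

Definition fixed_points phi : set X := [set x | forall t, 0 <= t -> phi t x = x].

End Flows.

(** * Algebras of functions *)

Section FunctionAlgebras.
Context {R : realType} {X : topologicalType}.
Implicit Types (phi : R -> X -> X) (u : X -> R) (A L : set (X -> R)).

Definition bounded_continuous : set (X -> R) :=
  [set u | continuous u /\ bounded_fun u].

(* The uniformity of [{uniform X -> R}] restricts on bounded functions to that
   of the sup norm. *)
Definition flow_unif_continuous phi : set (X -> R) :=
  [set u | bounded_continuous u /\
    unif_continuous (fun t : R => (u \o phi t) : {uniform X -> R})].

(* Subalgebras are unital: they contain the constants. *)
Definition closed_subalgebra A : Prop :=
  [/\ A `<=` bounded_continuous,
      forall c : R, A (cst c),
      forall u v, A u -> A v -> A (u \+ v),
      forall u v, A u -> A v -> A (u \* v)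
    & closed (A : set {uniform X -> R})].

Definition compactly_supported : set (X -> R) :=
  [set u | continuous u /\ compact (closure [set x | u x != 0])].

Definition flow_invariant_family phi A : Prop :=
  forall t, [set u \o phi t | u in A] = A.

Definition lyapunov phi : set (X -> R) :=
  [set u | bounded_continuous u /\
    forall x, {homo (fun t => u (phi t x)) : s t / s <= t}].

Definition le_rel u : set (X * X) := [set xy | u xy.1 <= u xy.2].

Definition sufficient phi L : Prop :=
  [/\ L `<=` lyapunov phi,
      L `<=` flow_unif_continuous phi
    & \bigcap_(u in L) le_rel u = GI phi].

End FunctionAlgebras.

(** * Compactifications *)

Section Compactifications.
Context {R : realType} {X Y : topologicalType}.
Implicit Types (phi : R -> X -> X) (i : X -> Y) (psi : R -> Y -> Y).

Definition proper_compactification i : Prop :=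
  [/\ compact [set: Y], hausdorff_space Y, topological_embedding i
    & dense (range i)].

Definition extendable_functions i : set (X -> R) :=
  [set u | bounded_continuous u /\
    exists2 v : Y -> R, continuous v & v \o i = u].

Definition flow_compactification phi i : Prop :=
  [/\ proper_compactification i,
      extendable_functions i `<=` flow_unif_continuous phi
    & flow_invariant_family phi (extendable_functions i)].

Definition flow_extension phi i psi : Prop :=
  is_flow psi /\ forall t x, psi t (i x) = i (phi t x).

Definition dynamic_compactification phi i psi : Prop :=
  [/\ flow_compactification phi i, flow_extension phi i psi
    & rel_trace i (GJ psi) = GJ phi].

Definition lyapunov_compactification phi i : Prop :=
  proper_compactification i /\
  exists L : set (X -> R),
    [/\ sufficient phi L, flow_invariant_family phi L
      & extendable_functions i
          = smallest closed_subalgebra (L `|` compactly_supported)].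

End Compactifications.

(* Main.v *)
Require Import Defs.
From HB Require Import structures.
From mathcomp Require Import all_boot all_order all_algebra.
From mathcomp Require Import all_classical all_reals.
From mathcomp Require Import topology normedtype.
From mathcomp Require Import ring lra.

Set Implicit Arguments.
Unset Strict Implicit.
Unset Printing Implicit Defensive.

Import Order.TTheory GRing.Theory Num.Theory.
Import numFieldNormedType.Exports.

Local Open Scope classical_set_scope.
Local Open Scope ring_scope.

(** A closed preorder on a locally compact, sigma-compact Hausdorff space is normal in Nachbin's
    sense: along an exhaustion by compact sets one builds increasing separating pairs. Urysohn's
    argument then gives continuous isotone functions separating every pair outside [GI phi], and
    the smoothing [x |-> sup_(0 <= s <= 1) (f (phi s x) - s)] makes them Lipschitz along the flow,
    so all Lyapunov functions that are uniformly continuous along the flow form a sufficient set.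
    Given an invariant sufficient set, the closure of the image of [X] in a product of lines is
    the compactification; its algebra is identified by the Stone-Weierstrass theorem, and the
    flow acts on it by shifting coordinates.

    For the properties of a compactification [Y], its points are separated by the extensions of
    the generating functions; those with compact support vanish on the remainder, so two
    remainder points that are related in both directions by [GI psi] coincide. Since
    [GJ (x, y)] holds iff [GI (phi 1 x, y)], all statements reduce to [GI]. That a remainder point
    of a class is in the closure of the trace of that class on [X] follows from a barrier
    argument: pairs in [GI psi] leaving an open set [U] can be factored through the boundary
    of [U], because the pairs with this property form a closed transitive relation. *)

(** * Compactness, chain closures and flows *)

(** Uniform continuity along the flow is what makes the extended flow jointly continuous: each
    coordinate then changes little under a small change of time, uniformly over the
    compactification. An isotone Urysohn function need not have it when [X] is not compact, hence
    the smoothing. The obstacle to normality is that the set of points above or below a closed set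
    need not be closed; for a compact set it is, hence the exhaustion. Metrizability needs countably
    many functions separating the points of the compactification. A metrizable [X] has a countable
    network, and choosing one function for each pair of network sets reduces a family of continuous
    functions to a countable one that separates the same pairs in the same order. Invariance brings
    back all translates, an uncountable family, but rational times approximate the others uniformly.
    Three countable families suffice: rational translates for two remainder points, compactly
    supported functions separating the points of [X], and compactly supported functions without
    common zero in [X] to tell it from the remainder. *)

Lemma compact_induction (T : topologicalType) (K : set T) (P : set (set T)) :
    compact K -> P set0 -> (forall A B, A `<=` B -> P B -> P A) ->
    (forall A B, P A -> P B -> P (A `|` B)) ->
    (forall x, K x -> exists2 U, nbhs x U & P U) ->
  P K.
Proof.
move=> cK P0 PS PU Ploc; apply: contrapT => nPK.
(* A failure of [P K] makes this a proper filter. It contains [K], and at a cluster point in [K] the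
   local hypothesis yields a member disjoint from a neighbourhood. *)
pose F : set_system T := [set A | P (K `\` A)].
have FF : ProperFilter F.
  split; first by move=> F0; apply: nPK; move: F0; rewrite /F /= setD0.
  split.
  - by rewrite /F /= setDT.
  - by move=> A B FA FB; rewrite /F /= setDIr; exact: PU.
  - by move=> A B AB; apply: PS; exact: setDS.
have FK : F K by rewrite /F /= setDv.
have [x [Kx clx]] := cK F FF FK.
have [U xU PU'] := Ploc x Kx.
have FU : F (~` U) by apply: PS PU' => y [_] /contrapT.
by have [y [nUy Uy]] := clx _ _ FU xU; exact: nUy.
Qed.

(** The tube lemma: the source below of every estimate that is uniform over a compact set of points
    or times. *)
Lemma compact_tube (S T : topologicalType) (K : set S) (C : set (S * T)) (t : T) :
  compact K -> (forall s, K s -> nbhs (s, t) C) ->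
  \forall t' \near t, forall s, K s -> C (s, t').
Proof.
move=> /compact_near_coveringP cK KC.
apply: (cK _ (nbhs t) (fun t s => C (s, t))) => s Ks.
have [[A B] /= [sA tB] AB] := KC s Ks; exists (A, B) => // -[s' t'] /= ABst.
exact: (AB (s', t')).
Qed.

Lemma compact_projection (S T : topologicalType) (K : set S) (C : set (S * T)) :
  compact K -> closed C -> closed [set t | exists2 s, K s & C (s, t)].
Proof.
move=> cK cC; rewrite -openC openE => t /= nt.
suff : \forall t' \near t, forall s, K s -> (~` C) (s, t').
  by apply: filterS => t' h [s Ks /(h s Ks)].
apply: compact_tube => // s Ks.
by apply: open_nbhs_nbhs; split; [exact: closed_openC|move=> ?; apply: nt; exists s].
Qed.

Lemma closed_preimage (S T : topologicalType) (f : S -> T) (C : set T) :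
  continuous f -> closed C -> closed (f @^-1` C).
Proof. by move=> cf; apply: preimage_closed => x _; exact: cf. Qed.

Lemma open_preimage (S T : topologicalType) (f : S -> T) (C : set T) :
  continuous f -> open C -> open (f @^-1` C).
Proof. by move=> cf; apply: open_comp => x _; exact: cf. Qed.

Lemma continuous_pair (S T U : topologicalType) (f : S -> T) (g : S -> U) :
  continuous f -> continuous g -> continuous (fun x => (f x, g x)).
Proof. by move=> cf cg x; apply: cvg_pair; [exact: cf|exact: cg]. Qed.

Lemma continuous_compose (S T U : topologicalType) (f : S -> T) (g : T -> U) :
  continuous f -> continuous g -> continuous (fun x => g (f x)).
Proof. by move=> cf cg x; apply: (@continuous_comp _ _ _ f g); [exact: cf|exact: cg]. Qed.

Lemma fst_cts (S T : topologicalType) : continuous (@fst S T).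
Proof. by move=> x; exact: cvg_fst. Qed.

Lemma snd_cts (S T : topologicalType) : continuous (@snd S T).
Proof. by move=> x; exact: cvg_snd. Qed.

Lemma id_cts (S : topologicalType) : continuous (fun x : S => x).
Proof. by move=> x; exact: cvg_id. Qed.

Lemma cst_cts (S T : topologicalType) (c : T) : continuous (fun _ : S => c).
Proof. by move=> x; exact: cvg_cst. Qed.

Lemma pair_cts_r (S T : topologicalType) (s : S) : continuous (pair s : T -> S * T).
Proof. by apply: continuous_pair; [exact: cst_cts|exact: id_cts]. Qed.

Lemma pair_cts_l (S T : topologicalType) (t : T) : continuous ((pair^~ t) : S -> S * T).
Proof. by apply: continuous_pair; [exact: id_cts|exact: cst_cts]. Qed.

Lemma closed_diagonal (T : topologicalType) : hausdorff_space T ->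
  closed [set xy : T * T | xy.1 = xy.2].
Proof.
move=> hT [x y] cl /=; apply: hT => A B xA yB.
have [|[a b] /= [<- [Aa Bb]]] := cl (A `*` B); first by exists (A, B).
by exists a.
Qed.

Section ChainClosure.
Context {T : topologicalType}.
Implicit Types g h : set (T * T).

Lemma sub_chain_closure g : g `<=` chain_closure g.
Proof. exact: sub_smallest. Qed.

Lemma chain_closure_min g h :
  closed h -> rel_transitive h -> g `<=` h -> chain_closure g `<=` h.
Proof. by move=> ch th gh; apply: smallest_sub. Qed.

Lemma chain_closure_closed g : closed (chain_closure g).
Proof.
by rewrite /chain_closure /smallest; apply: closed_bigI => A [[]].
Qed.

Lemma chain_closure_trans g : rel_transitive (chain_closure g).
Proof.
move=> x y z xy yz A [[cA tA] gA].
by apply: (tA _ y); [apply: xy|apply: yz].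
Qed.

Lemma rel_class_refl g x : rel_diag g x -> rel_class g x x.
Proof. by move=> gx; split. Qed.

End ChainClosure.

(** * The relations [GI] and [GJ] of a flow *)

Section FlowFacts.
Context {R : realType} {X : topologicalType} (phi : R -> X -> X).
Context (hphi : is_flow phi).

Lemma flow_cts2 : continuous (fun tx : R * X => phi tx.1 tx.2).
Proof. by case: hphi. Qed.

Lemma flow0 x : phi 0 x = x. Proof. by case: hphi. Qed.

Lemma flowD s t x : phi (s + t) x = phi s (phi t x).
Proof. by case: hphi. Qed.

Lemma flow_cts t : continuous (phi t).
Proof. exact: (continuous_compose (@pair_cts_r R X t) flow_cts2). Qed.

Lemma flow_orbit_cts x : continuous (phi^~ x).
Proof.
exact: (continuous_compose (@pair_cts_l R X x) flow_cts2).
Qed.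

Lemma flowK t : cancel (phi t) (phi (- t)).
Proof. by move=> x; rewrite -flowD addNr flow0. Qed.

Lemma flowNK t : cancel (phi (- t)) (phi t).
Proof. by move=> x; rewrite -flowD subrr flow0. Qed.

Lemma flowC s t x : phi s (phi t x) = phi t (phi s x).
Proof. by rewrite -!flowD addrC. Qed.

Lemma flow_rel_closed (K : set R) : hausdorff_space X ->
  compact K -> closed (flow_rel phi K).
Proof.
move=> hX cK.
pose C : set (R * (X * X)) := [set p | p.2.2 = phi p.1 p.2.1].
have cC : closed C.
  apply: (@closed_preimage _ _ (fun p : R * (X * X) => (p.2.2, phi p.1 p.2.1))
    [set xy | xy.1 = xy.2]).
    apply: continuous_pair.
      exact: (continuous_compose (@snd_cts _ _) (@snd_cts _ _)).
    apply: (@continuous_compose _ _ _ (fun p : R * (X * X) => (p.1, p.2.1))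
      (fun tx : R * X => phi tx.1 tx.2)); last exact: flow_cts2.
    apply: continuous_pair; first exact: fst_cts.
    exact: (continuous_compose (@snd_cts _ _) (@fst_cts _ _)).
  exact: closed_diagonal.
exact: (compact_projection cK cC).
Qed.

Lemma GI_trans : rel_transitive (GI phi).
Proof. exact: chain_closure_trans. Qed.

Lemma GI_closed : closed (GI phi).
Proof. exact: chain_closure_closed. Qed.

Lemma GJ_trans : rel_transitive (GJ phi).
Proof. exact: chain_closure_trans. Qed.

Lemma GJ_closed : closed (GJ phi).
Proof. exact: chain_closure_closed. Qed.

Lemma flow_rel_mem (K : set R) t x : K t -> flow_rel phi K (x, phi t x).
Proof. by exists t. Qed.

Lemma GI_small t x : 0 <= t <= 1 -> GI phi (x, phi t x).
Proof.
by move=> t01; apply: sub_chain_closure; apply: flow_rel_mem; rewrite /= in_itv.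
Qed.

Lemma GJ_small t x : 1 <= t <= 2 -> GJ phi (x, phi t x).
Proof.
by move=> t12; apply: sub_chain_closure; apply: flow_rel_mem; rewrite /= in_itv.
Qed.

Lemma GI_refl x : GI phi (x, x).
Proof. by rewrite -{2}(flow0 x); apply: GI_small; rewrite lexx ler01. Qed.

Lemma GI_natmul n t x : 0 <= t <= 1 -> GI phi (x, phi (n%:R * t) x).
Proof.
move=> t01; elim: n => [|n IH]; first by rewrite mul0r flow0; exact: GI_refl.
apply: GI_trans IH _; rewrite -natr1 mulrDl mul1r addrC flowD.
exact: GI_small.
Qed.

Lemma nat_fraction (t : R) : 0 <= t -> exists n t', 0 <= t' <= 1 /\ t = n%:R * t'.
Proof.
move=> t0; pose n := (Num.truncn t).+1; exists n, (t / n%:R).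
have n0 : 0 < n%:R :> R by rewrite ltr0n.
split; last by rewrite mulrCA divff ?mulr1 // gt_eqF.
rewrite divr_ge0 ?(ltW n0)//= ler_pdivrMr // mul1r ltW //.
by have /andP[] := truncn_itv t0.
Qed.

Lemma GI_flow t x : 0 <= t -> GI phi (x, phi t x).
Proof. by move=> /nat_fraction [n [t' [t01 ->]]]; exact: GI_natmul. Qed.

Lemma GI_equivariant t x y : GI phi (x, y) -> GI phi (phi t x, phi t y).
Proof.
pose h : set (X * X) := [set p | GI phi (phi t p.1, phi t p.2)].
suff : GI phi `<=` h by move=> /[apply].
apply: chain_closure_min.
- apply: (@closed_preimage _ _ (fun p : X * X => (phi t p.1, phi t p.2)) (GI phi)).
    apply: continuous_pair.
      exact: (continuous_compose (@fst_cts _ _) (@flow_cts _)).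
    exact: (continuous_compose (@snd_cts _ _) (@flow_cts _)).
  exact: GI_closed.
- by move=> a b c; exact: GI_trans.
- move=> [a b] [s] /=; rewrite in_itv /= => s01 ->.
  by rewrite /h /= flowC; exact: GI_small.
Qed.

(** Intersecting with [GJ phi] makes the auxiliary relation transitive: in a composite only the last
    factor has to absorb [phi s]. *)
Lemma GJ_flow_r s x y : 0 <= s <= 1 -> GJ phi (x, y) -> GJ phi (x, phi s y).
Proof.
move=> s01.
pose h : set (X * X) := GJ phi `&` [set p | GJ phi (p.1, phi s p.2)].
suff : GJ phi `<=` h by move=> /[apply] -[].
apply: chain_closure_min.
- apply: closedI; first exact: GJ_closed.
  apply: (@closed_preimage _ _ (fun p : X * X => (p.1, phi s p.2)) (GJ phi)).
    apply: continuous_pair; first exact: fst_cts.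
    exact: (continuous_compose (@snd_cts _ _) (@flow_cts _)).
  exact: GJ_closed.
- move=> a b c [ab ab'] [bc bc']; split; first exact: GJ_trans ab bc.
  exact: GJ_trans ab bc'.
- move=> [a b] [t] /=; rewrite in_itv /= => t12 ->.
  split; first exact: GJ_small.
  rewrite /= -flowD.
  have [st2|st2] := leP (s + t) 2.
    by apply: GJ_small; rewrite st2 andbT; lra.
  (* As [2 < s + t <= 3], each half is a time in [[1, 2]]. *)
  have -> : s + t = (s + t) / 2 + (s + t) / 2 by lra.
  by rewrite flowD; apply: (@GJ_trans _ (phi ((s + t) / 2) a));
    apply: GJ_small; lra.
Qed.

Lemma GJ_flow_l s x y : 0 <= s <= 1 -> GJ phi (x, y) -> GJ phi (phi (- s) x, y).
Proof.
move=> s01.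
pose h : set (X * X) := GJ phi `&` [set p | GJ phi (phi (- s) p.1, p.2)].
suff : GJ phi `<=` h by move=> /[apply] -[].
apply: chain_closure_min.
- apply: closedI; first exact: GJ_closed.
  apply: (@closed_preimage _ _ (fun p : X * X => (phi (- s) p.1, p.2)) (GJ phi)).
    apply: continuous_pair; last exact: snd_cts.
    exact: (continuous_compose (@fst_cts _ _) (@flow_cts _)).
  exact: GJ_closed.
- move=> a b c [ab ab'] [bc bc']; split; first exact: GJ_trans ab bc.
  exact: GJ_trans ab' bc.
- move=> [a b] [t] /=; rewrite in_itv /= => t12 ->.
  split; first exact: GJ_small.
  rewrite /= -{2}(flowNK s a); set a' := phi (- s) a; rewrite -flowD.
  have [st2|st2] := leP (t + s) 2.
    by apply: GJ_small; rewrite st2 andbT; lra.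
  have -> : t + s = (t + s) / 2 + (t + s) / 2 by lra.
  by rewrite flowD; apply: (@GJ_trans _ (phi ((t + s) / 2) a'));
    apply: GJ_small; lra.
Qed.

Lemma GJ_sub_GI : GJ phi `<=` GI phi.
Proof.
apply: chain_closure_min; [exact: GI_closed|exact: GI_trans|].
move=> [a b] [t] /=; rewrite in_itv /= => t12 ->; apply: GI_flow; lra.
Qed.

Context (hX : hausdorff_space X).

(** The right-hand side is itself closed and transitive. Two flow steps compose to a time that is at
    most 1 or lies in [[1, 2]], and a flow step next to a [GJ] pair is absorbed by [GJ_flow_l] or
    [GJ_flow_r]. *)
Lemma GI_decomposition : GI phi `<=` flow_rel phi `[0, 1] `|` GJ phi.
Proof.
apply: chain_closure_min; last by move=> p; left.
- apply: closedU; last exact: GJ_closed.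
  by apply: flow_rel_closed => //; exact: segment_compact.
- move=> a b c [[s + bE]|ab] [[t + cE]|bc].
  + rewrite /= in bE cE; rewrite /= !in_itv /= cE bE => s01 t01; rewrite -flowD.
    have [ts|ts] := leP (t + s) 1.
      by left; apply: flow_rel_mem; rewrite /= in_itv /=; lra.
    by right; apply: GJ_small; lra.
  + rewrite /= in bE; rewrite /= in_itv /= => s01; right.
    by rewrite -(flowK s a) -bE; exact: GJ_flow_l.
  + rewrite /= in cE; rewrite /= in_itv /= cE => t01; right; exact: GJ_flow_r.
  + by right; exact: GJ_trans bc.
Qed.

(** Forward, the relation on the right is closed, transitive because [a] precedes [phi 1 a], and
    contains the generators. Backward, by the decomposition of [GI], time 1 followed by a time in
    [[0, 1]] is a time in [[1, 2]]. *)
Lemma GJP x y : GJ phi (x, y) <-> GI phi (phi 1 x, y).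
Proof.
split.
  pose h : set (X * X) := [set p | GI phi (phi 1 p.1, p.2)].
  suff : GJ phi `<=` h by move=> /[apply].
  apply: chain_closure_min.
  - apply: (@closed_preimage _ _ (fun p : X * X => (phi 1 p.1, p.2)) (GI phi)).
      apply: continuous_pair; last exact: snd_cts.
      exact: (continuous_compose (@fst_cts _ _) (@flow_cts _)).
    exact: GI_closed.
  - move=> a b c /= ab bc; apply: GI_trans ab _; apply: GI_trans bc.
    exact: GI_flow.
  - move=> [a b] [t] /=; rewrite in_itv /= => t12 ->.
    rewrite /h /= (_ : phi t a = phi (t - 1) (phi 1 a)).
      by apply: GI_small; lra.
    by rewrite -flowD subrK.
move=> /GI_decomposition[[s /=]|].
  rewrite in_itv /= -flowD => s01 ->; apply: GJ_small; lra.
by apply: GJ_trans; apply: GJ_small; lra.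
Qed.

(** Recurrence of [x] means that [phi 1 x] precedes [x]. If [y] precedes [x], then by equivariance
    [phi 1 y] precedes [phi 1 x], hence [x]. *)
Lemma rel_class_GJ x : rel_diag (GJ phi) x ->
  rel_class (GJ phi) x = rel_class (GI phi) x.
Proof.
move=> /GJP xx; apply/seteqP; split=> y [xy yx].
  by split; exact: GJ_sub_GI.
split; apply/GJP; first exact: GI_trans xx xy.
apply: (@GI_trans _ (phi 1 x)) => //=.
exact: (GI_equivariant _ yx).
Qed.

Lemma rel_class_diag x y : rel_diag (GJ phi) x -> rel_class (GI phi) x y ->
  rel_diag (GJ phi) y.
Proof.
by move=> xx; rewrite -rel_class_GJ // => -[xy yx]; exact: GJ_trans yx xy.
Qed.

End FlowFacts.

Arguments flow_cts {R X phi} hphi t.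
Arguments flow_orbit_cts {R X phi} hphi x.

(** * Normality of closed preorders *)

Lemma locally_compact_nbhs (T : topologicalType) (x : T) :
  locally_compact [set: T] -> exists2 C, nbhs x C & compact C.
Proof.
move=> /(_ x Logic.I) [C xC [cC _]]; exists C => //.
by move: xC; rewrite withinET.
Qed.

Lemma compact_exhaustion (T : topologicalType) :
    locally_compact [set: T] -> sigma_compact T ->
  exists K : nat -> set T, [/\ forall n, compact (K n),
    forall n, K n `<=` (K n.+1)° & \bigcup_n K n = setT].
Proof.
move=> lc [C cC CT].
have thick (A : set T) : exists B, compact A -> compact B /\ A `<=` B°.
  have [cA|ncA] := pselect (compact A); last by exists A.
  suff [B cB AB] : exists2 B, compact B & A `<=` B° by exists B.
  apply: (compact_induction (P := fun A => exists2 B, compact B & A `<=` B°)) => //.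
  - by exists set0 => //; exact: compact0.
  - by move=> A1 B1 AB [B2 cB2 B12]; exists B2 => //; exact: subset_trans B12.
  - move=> A1 B1 [A2 cA2 A12] [B2 cB2 B12]; exists (A2 `|` B2).
      exact: compactU.
    apply: subset_trans (@interiorU _ _ _); exact: setUSS.
  - move=> x _; have [D xD cD] := locally_compact_nbhs x lc.
    by exists D°; [exact: nbhs_interior|exists D].
have [th Hth] := choice thick.
pose K := fix K n := if n is m.+1 then th (K m `|` C m) else C 0%N.
have cK n : compact (K n).
  by elim: n => //= n IH; apply: (Hth _ _).1; exact: compactU.
have KS n : K n `|` C n `<=` (K n.+1)°.
  by apply: (Hth _ _).2; exact: compactU.
exists K; split => //.
  by move=> n x Kx; apply: KS; left.
apply/seteqP; split => // x _.
have : (\bigcup_n C n) x by rewrite CT.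
by move=> [n _ Cx]; exists n.+1 => //; apply: interior_subset; apply: KS; right.
Qed.

(** Two nested compactness inductions: on [A] and, at a fixed point of [A], on [B]. At a single pair
    of points, regularity shrinks a product neighbourhood missing [G] to a product of closed
    ones. *)
Lemma compact_separated_nbhs (S T : topologicalType) (G : set (S * T))
    (A : set S) (B : set T) :
    regular_space S -> regular_space T -> closed G -> compact A -> compact B ->
    (forall a b, A a -> B b -> ~ G (a, b)) ->
  exists C D, [/\ closed C, closed D, A `<=` C°, B `<=` D° &
    forall c d, C c -> D d -> ~ G (c, d)].
Proof.
move=> rS rT cG cA cB AB.
apply: (compact_induction (P := fun A => exists C D, [/\ closed C, closed D,
  A `<=` C°, B `<=` D° & forall c d, C c -> D d -> ~ G (c, d)]) cA).
- by exists set0, setT; split => //; [exact: closed0|rewrite interiorT].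
- move=> A1 A2 A12 [C [D [cC cD AC BD CD]]]; exists C, D; split => //.
  exact: subset_trans AC.
- move=> A1 A2 [C [D [cC cD AC BD CD]]] [C' [D' [cC' cD' AC' BD' CD']]].
  exists (C `|` C'), (D `&` D'); split.
  + exact: closedU.
  + exact: closedI.
  + apply: subset_trans (@interiorU _ _ _); exact: setUSS.
  + by rewrite interiorI => b Bb; split; [exact: BD|exact: BD'].
  + by move=> c d [Cc|Cc] [Dd Dd']; [exact: CD|exact: CD'].
- move=> a Aa.
  suff [C [D [cC cD aC BD CD]]] : exists C D, [/\ closed C, closed D, nbhs a C,
     B `<=` D° & forall c d, C c -> D d -> ~ G (c, d)].
    exists C°; first exact: nbhs_interior.
    by exists C, D; split.
  apply: (compact_induction (P := fun B => exists C D, [/\ closed C, closed D,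
    nbhs a C, B `<=` D° & forall c d, C c -> D d -> ~ G (c, d)]) cB).
  + exists setT, set0; split => //; [exact: closed0|exact: filterT].
  + move=> B1 B2 B12 [C [D [cC cD aC BD CD]]]; exists C, D; split => //.
    exact: subset_trans BD.
  + move=> B1 B2 [C [D [cC cD aC BD CD]]] [C' [D' [cC' cD' aC' BD' CD']]].
    exists (C `&` C'), (D `|` D'); split.
    * exact: closedI.
    * exact: closedU.
    * exact: filterI.
    * apply: subset_trans (@interiorU _ _ _); exact: setUSS.
    * by move=> c d [Cc Cc'] [Dd|Dd]; [exact: CD|exact: CD'].
  + move=> b Bb.
    have : nbhs (a, b) (~` G).
      by apply: open_nbhs_nbhs; split; [exact: closed_openC|exact: AB].
    move=> [[P Q] /= [aP bQ] PQ].
    have [P' aP' PP] := rS a _ aP; have [Q' bQ' QQ] := rT b _ bQ.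
    exists Q'°; first exact: nbhs_interior.
    exists (closure P'), (closure Q'); split.
    * exact: closed_closure.
    * exact: closed_closure.
    * by apply: filterS aP'; exact: subset_closure.
    * by apply: interiorS; exact: subset_closure.
    * by move=> c d Cc Dd; apply: (PQ (c, d)); split; [exact: PP|exact: QQ].
Qed.

Definition down_closed (T : Type) (G : set (T * T)) (A : set T) :=
  forall x y, A y -> G (x, y) -> A x.

Definition up_closed (T : Type) (G : set (T * T)) (A : set T) :=
  forall x y, A x -> G (x, y) -> A y.

Section PreorderNormality.
Context {X : topologicalType} (G : set (X * X)).
Context (rX : regular_space X)
  (lcX : locally_compact [set: X]) (scX : sigma_compact X).
Context (cG : closed G) (tG : rel_transitive G) (rG : forall x, G (x, x)).

Let down (S : set X) : set X := [set x | exists2 s, S s & G (x, s)].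
Let up (S : set X) : set X := [set x | exists2 s, S s & G (s, x)].

Let down_compact S : compact S -> closed (down S).
Proof.
move=> cS; apply: (compact_projection cS (C := [set p : X * X | G (p.2, p.1)])).
apply: (@closed_preimage _ _ (fun p : X * X => (p.2, p.1)) G) => //.
by apply: continuous_pair; [exact: snd_cts|exact: fst_cts].
Qed.

Let up_compact S : compact S -> closed (up S).
Proof. by move=> cS; exact: (compact_projection cS cG). Qed.

(** On each [K n] a pair of disjoint compact sets is kept, monotone relative to [K n] and containing
    the traces of [A0] and [B0]. Each set lies in the interior of its successor, so that the unions
    are open; monotonicity passes to the unions because any given point lies in some [K n]. *)
Lemma preorder_normal (A0 B0 : set X) :
    closed A0 -> closed B0 -> down_closed G A0 -> up_closed G B0 ->
    A0 `&` B0 `<=` set0 ->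
  exists U V, [/\ open U, open V, down_closed G U, up_closed G V &
    [/\ A0 `<=` U, B0 `<=` V & U `&` V `<=` set0]].
Proof.
move=> cA0 cB0 dA0 uB0 AB0.
have [K [cK KS KT]] := compact_exhaustion lcX scX.
have Kmono n : K n `<=` K n.+1.
  exact: subset_trans (KS n) (@interior_subset _ _).
pose good n (p : set X * set X) := [/\ compact p.1, compact p.2,
  p.1 `<=` K n /\ p.2 `<=` K n, p.1 `&` p.2 `<=` set0 &
  [/\ forall z a, K n z -> p.1 a -> G (z, a) -> p.1 z,
      forall z b, K n z -> p.2 b -> G (b, z) -> p.2 z,
      A0 `&` K n `<=` p.1 & B0 `&` K n `<=` p.2]].
have step (np : nat * (set X * set X)) : exists q, good np.1 np.2 ->
    [/\ good np.1.+1 q, np.2.1 `<=` q.1° & np.2.2 `<=` q.2°].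
  move: np => [n [A B]] /=.
  have [|ng] := pselect (good n (A, B)); last by exists (A, B).
  move=> [/= cA cB [AK BK] AB [dA uB A0A B0B]].
  pose A' := (down A `|` A0) `&` K n.+1; pose B' := (up B `|` B0) `&` K n.+1.
  have cA' : compact A'.
    rewrite /A' setIC; apply: compact_closedI => //.
    by apply: closedU => //; exact: down_compact.
  have cB' : compact B'.
    rewrite /B' setIC; apply: compact_closedI => //.
    by apply: closedU => //; exact: up_compact.
  (* By transitivity such a relation extends to one from [B] or [B0] to [A] or [A0]; monotonicity of
     these sets then yields a common point of [A] and [B], or of [A0] and [B0]. *)
  have AB' b a : B' b -> A' a -> ~ G (b, a).
    move=> [[[b' Bb' bb']|Bb] _] [[[a' Aa' aa']|Aa] _] ba.
    - apply: (AB a'); split => //; apply: (uB _ b') => //; first exact: AK.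
      exact: (tG bb' (tG ba aa')).
    - apply: (AB b'); split => //; apply: A0A; split; last exact: BK.
      exact: (dA0 _ _ Aa (tG bb' ba)).
    - apply: (AB a'); split => //; apply: B0B; split; last exact: AK.
      exact: (uB0 _ _ Bb (tG ba aa')).
    - by apply: (AB0 a); split => //; exact: (uB0 _ _ Bb ba).
  have [D [C [cD cC BD AC DC]]] := compact_separated_nbhs rX rX cG cB' cA' AB'.
  (* [C] and [D] need not be monotone. Their saturations inside [K n.+1] are, and stay disjoint: a
     common point would relate a point of [D] to a point of [C]. *)
  pose A1 := down (C `&` K n.+1) `&` K n.+1.
  pose B1 := up (D `&` K n.+1) `&` K n.+1.
  have CA1 : C `&` K n.+1 `<=` A1.
    by move=> x [Cx Kx]; split => //; exists x.
  have DB1 : D `&` K n.+1 `<=` B1.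
    by move=> x [Dx Kx]; split => //; exists x.
  exists (A1, B1) => _ /=; split; first split => /=.
  - rewrite /A1 setIC; apply: compact_closedI => //; apply: down_compact.
    by rewrite setIC; exact: compact_closedI.
  - rewrite /B1 setIC; apply: compact_closedI => //; apply: up_compact.
    by rewrite setIC; exact: compact_closedI.
  - by split => x [].
  - move=> x [[[c [Cc _] xc] _] [[d [Dd _] dx] _]].
    by apply: (DC d c) => //; exact: tG dx xc.
  - split.
    + move=> z a Kz [[c Cc ac] _] za; split => //; exists c => //.
      exact: tG za ac.
    + move=> z b Kz [[d Dd db] _] bz; split => //; exists d => //.
      exact: tG db bz.
    + move=> x [Ax Kx]; apply: CA1; split => //.
      by apply: interior_subset; apply: AC; split => //; right.
    + move=> x [Bx Kx]; apply: DB1; split => //.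
      by apply: interior_subset; apply: BD; split => //; right.
  - apply: subset_trans (interiorS CA1); rewrite interiorI => x Ax; split.
      apply: AC; split; last exact/Kmono/AK.
      by left; exists x.
    exact/KS/AK.
  - apply: subset_trans (interiorS DB1); rewrite interiorI => x Bx; split.
      apply: BD; split; last exact/Kmono/BK.
      by left; exists x.
    exact/KS/BK.
have [nx Hnx] := choice step.
pose p := fix p n := if n is m.+1 then nx (m, p m) else (A0 `&` K 0%N, B0 `&` K 0%N).
have gp n : good n (p n).
  elim: n => [|n IH]; last by have [] := Hnx (n, p n) IH.
  split => /=.
  - by rewrite setIC; exact: compact_closedI.
  - by rewrite setIC; exact: compact_closedI.
  - by split => x [].
  - by move=> x [[? _] [? _]]; exact: (AB0 x).
  - split => //; first by move=> z a Kz [Aa _] za; split => //; exact: dA0 Aa za.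
    by move=> z b Kz [Bb _] bz; split => //; exact: uB0 Bb bz.
have Aint n : (p n).1 `<=` (p n.+1).1° by have [] := Hnx (n, p n) (gp n).
have Bint n : (p n).2 `<=` (p n.+1).2° by have [] := Hnx (n, p n) (gp n).
have Kle m n : (m <= n)%N -> K m `<=` K n.
  by move=> /subnK <-; elim: (n - m)%N => // k; rewrite addSn => IH;
    exact: subset_trans IH (Kmono _).
have Ale m n : (m <= n)%N -> (p m).1 `<=` (p n).1.
  move=> /subnK <-; elim: (n - m)%N => // k; rewrite addSn => IH.
  exact: subset_trans IH (subset_trans (Aint _) (@interior_subset _ _)).
have Ble m n : (m <= n)%N -> (p m).2 `<=` (p n).2.
  move=> /subnK <-; elim: (n - m)%N => // k; rewrite addSn => IH.
  exact: subset_trans IH (subset_trans (Bint _) (@interior_subset _ _)).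
have inK x : exists n, K n x.
  by have [n _ Kx] : (\bigcup_n K n) x; [rewrite KT|exists n].
exists (\bigcup_n (p n).1), (\bigcup_n (p n).2); split; last split.
- rewrite openE => x [n _ px]; apply: (@filterS _ _ _ (p n.+1).1).
    by move=> y ?; exists n.+1.
  exact: Aint px.
- rewrite openE => x [n _ px]; apply: (@filterS _ _ _ (p n.+1).2).
    by move=> y ?; exists n.+1.
  exact: Bint px.
- move=> x y [n _ py] xy; have [m Kx] := inK x.
  exists (maxn m n) => //; have [_ _ _ _ [dp _ _ _]] := gp (maxn m n).
  apply: (dp _ y) => //; first exact: (Kle m _ (leq_maxl _ _)).
  exact: (Ale n _ (leq_maxr _ _)).
- move=> x y [n _ px] xy; have [m Ky] := inK y.
  exists (maxn m n) => //; have [_ _ _ _ [_ upn _ _]] := gp (maxn m n).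
  apply: (upn _ x) => //; first exact: (Kle m _ (leq_maxl _ _)).
  exact: (Ble n _ (leq_maxr _ _)).
- move=> x Ax; have [n Kx] := inK x; exists n => //.
  by have [_ _ _ _ [_ _ h _]] := gp n; exact: h.
- move=> x Bx; have [n Kx] := inK x; exists n => //.
  by have [_ _ _ _ [_ _ _ h]] := gp n; exact: h.
- move=> x [[n _ Ax] [m _ Bx]]; have [_ _ _ h _] := gp (maxn m n).
  apply: (h x); split; first exact: (Ale n _ (leq_maxr _ _)).
  exact: (Ble m _ (leq_maxl _ _)).
Qed.

End PreorderNormality.

(** * Order-preserving Urysohn functions *)

(** [F n k] sits at the dyadic number [k / 2 ^ n]. The next level keeps the old members at even
    indices and inserts interpolants at odd ones. *)
Lemma dyadic_interpolation (S : Type) (r : S -> S -> Prop) (p0 p1 : S) :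
    (forall p q, r p q -> exists2 m, r p m & r m q) -> r p0 p1 ->
  exists F : nat -> nat -> S, [/\ forall n, F n 0%N = p0,
    forall n, F n (2 ^ n)%N = p1,
    forall n k, (k < 2 ^ n)%N -> r (F n k) (F n k.+1) &
    forall n k, F n.+1 k.*2 = F n k].
Proof.
move=> interp r01.
have ex_mid (pq : S * S) : exists m, r pq.1 pq.2 -> r pq.1 m /\ r m pq.2.
  have [/interp[m pm mq]|npq] := pselect (r pq.1 pq.2); first by exists m.
  by exists pq.1.
have [mid Hmid] := choice ex_mid.
pose F := fix F n k := if n is m.+1 then
    if odd k then mid (F m k./2, F m k./2.+1) else F m k./2
  else if k is 0%N then p0 else p1.
have FS n k : F n.+1 k.*2 = F n k by rewrite /= odd_double doubleK.
exists F; split => //.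
- by elim=> //= n ->.
- by elim=> // n IH; rewrite expnS mul2n FS.
elim=> [|n IH] k; first by case: k.
rewrite expnS mul2n.
suff key j (b : bool) : (b + j.*2 < (2 ^ n).*2)%N ->
    r (F n.+1 (b + j.*2)%N) (F n.+1 (b + j.*2).+1) by rewrite -(odd_double_half k); exact: key.
case: b => [|]; rewrite ?add1n ?add0n.
  rewrite ltn_Sdouble => jn; rewrite -doubleS FS.
  rewrite [F n.+1 j.*2.+1]/= odd_double /= uphalf_double.
  exact: (Hmid (_, _) (IH _ jn)).2.
rewrite ltn_double => jn; rewrite FS.
rewrite [F n.+1 j.*2.+1]/= odd_double /= uphalf_double.
exact: (Hmid (_, _) (IH _ jn)).1.
Qed.

Section PreorderUrysohn.
Context {R : realType} {X : topologicalType} (G : set (X * X)).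
Context (rX : regular_space X).
Context (lcX : locally_compact [set: X]) (scX : sigma_compact X).
Context (cG : closed G) (tG : rel_transitive G) (rG : forall x, G (x, x)).

(** The closure of a down-closed set need not be down-closed, so each member of the Urysohn scale
    carries an open set together with a closed one around it, instead of an open set and its
    closure. *)
Let slab (p : set X * set X) := [/\ open p.1, closed p.2,
  down_closed G p.1, down_closed G p.2 & p.1 `<=` p.2].

Let below (p q : set X * set X) := [/\ slab p, slab q & p.2 `<=` q.1].

(** Normality is applied to the closed part of [p] and the complement of the open part of [q], which
    is up-closed. *)
Let below_interpolation p q : below p q -> exists2 m, below p m & below m q.
Proof.
move=> [sp sq pq].
have [op cp d1p d2p p12] := sp; have [oq cq d1q d2q q12] := sq.
have [|x [px nqx]|U [V [oU oV dU uV [pU qV UV]]]] :=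
  preorder_normal rX lcX scX cG tG rG cp (open_closedC oq) d2p.
- by move=> x y nx xy qy; apply: nx; exact: d1q qy xy.
- by apply: nqx; exact: pq.
have UV' : U `<=` ~` V by move=> x Ux Vx; apply: (UV x).
have sm : slab (U, ~` V).
  split => //=; first exact: open_closedC.
  by move=> x y nVy xy Vx; apply: nVy; exact: uV Vx xy.
exists (U, ~` V); split => //=.
by move=> x nVx; apply: contrapT => nqx; apply: nVx; exact: qV.
Qed.

Lemma preorder_urysohn (A B : set X) :
    closed A -> closed B -> down_closed G A -> up_closed G B ->
    A `&` B `<=` set0 ->
  exists f : X -> R, [/\ continuous f, forall x, 0 <= f x <= 1,
    forall x y, G (x, y) -> f x <= f y,
    forall x, A x -> f x = 0 & forall x, B x -> f x = 1].
Proof.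
move=> cA cB dA uB AB.
have AB' : A `<=` ~` B by move=> x Ax Bx; apply: (AB x).
(* The closed part [A] at level 0 forces [f = 0] on [A]; at level 1 the closed part [setT] gives
   [f <= 1], and the open part, which avoids [B], forces [f = 1] on [B]. *)
have b01 : below (set0, A) (~` B, setT).
  split => //; split => //=; [exact: open0|exact: closed_openC|].
  by move=> x y nBy xy Bx; apply: nBy; exact: uB Bx xy.
have [F [F0 F1 FS F2]] := dyadic_interpolation below_interpolation b01.
pose W n k := (F n k).2; pose V n k := (F n k).1.
have slabF n k : (k <= 2 ^ n)%N -> slab (F n k).
  case: k => [|k] kn; first by rewrite F0; case: b01.
  by case: (FS n k kn).
have VW n k : (k <= 2 ^ n)%N -> V n k `<=` W n k by move=> /slabF [].
have WV n k : (k < 2 ^ n)%N -> W n k `<=` V n k.+1 by move=> /FS [].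
have WW n k l : (k <= l)%N -> (l <= 2 ^ n)%N -> W n k `<=` W n l.
  move=> /subnK <-; elim: (l - k)%N => [|j IH]; first by move=> _ ?.
  rewrite addSn => jn.
  apply: subset_trans (IH (ltnW jn)) _.
  exact: subset_trans (WV _ _ jn) (VW _ _ jn).
have FD m n k : F (m + n)%N (2 ^ m * k)%N = F n k.
  elim: m => [|m IH]; first by rewrite mul1n.
  by rewrite expnS -mulnA mul2n addSn F2.
have p2 n : 0 < 2 ^+ n :> R by rewrite exprn_gt0.
(* Both indices are refined to the common level [m + n], at which the sets increase with the
   index. *)
have Wle m l n k : (l <= 2 ^ m)%N -> (k <= 2 ^ n)%N ->
    l%:R / 2 ^+ m <= k%:R / 2 ^+ n :> R -> W m l `<=` W n k.
  move=> lm kn; rewrite ler_pdivrMr // mulrAC ler_pdivlMr // -!natrX -!natrM.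
  rewrite ler_nat => h.
  rewrite /W -(FD n m l) -(FD m n k) (addnC m n) -/(W _ _).
  by apply: WW; [rewrite mulnC [leqRHS]mulnC|rewrite expnD mulnC leq_mul].
pose S x : set R := [set r | exists n k, [/\ (k <= 2 ^ n)%N, W n k x & r = k%:R / 2 ^+ n]].
pose f x : R := inf (S x).
have S1 x : S x 1.
  exists 0%N, 1%N; split => //; last by rewrite divr1.
  by rewrite /W (F1 0%N).
have lbS x c : lbound (S x) c -> c <= f x.
  by move=> lb; apply: lb_le_inf => //; exists 1.
have S0 x : lbound (S x) 0.
  by move=> _ [n [k [_ _ ->]]]; rewrite divr_ge0 // ltW.
have fle x r : S x r -> f x <= r.
  by move=> Sxr; apply: ge_inf => //; exists 0.
have f0 x : 0 <= f x by exact: lbS.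
have f1 x : f x <= 1 by exact: fle.
have fW x n k : (k <= 2 ^ n)%N -> W n k x -> f x <= k%:R / 2 ^+ n.
  by move=> kn Wx; apply: fle; exists n, k.
have fnW x n k : (k <= 2 ^ n)%N -> ~ W n k x -> k%:R / 2 ^+ n <= f x.
  move=> kn nWx; apply: lbS => _ [m [l [lm Wx ->]]]; rewrite leNgt; apply/negP.
  by move=> /ltW lk; apply: nWx; exact: (Wle _ _ _ _ lm kn lk).
exists f; split.
- move=> x; apply/cvgrPdist_lt => e e0.
  have [n hn] : exists n, 2 / 2 ^+ n < e.
    exists (Num.truncn (2 / e)).+1; rewrite ltr_pdivrMr // mulrC -ltr_pdivrMr //.
    apply: lt_trans (_ : (Num.truncn (2 / e)).+1%:R < _); first exact: truncnS_gt.
    by rewrite -natrX ltr_nat ltn_expl.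
  (* For the least such [k], the point [x] is in the open [V n k.+1] and outside the closed
     [W n k.-1], apart from the end cases. Nearby values then lie between [(k - 1) / 2 ^ n] and
     [(k + 1) / 2 ^ n], an interval shorter than [e]. *)
  have exW : exists k, (k <= 2 ^ n)%N && `[< W n k x >].
    by exists (2 ^ n)%N; rewrite leqnn; apply/asboolP; rewrite /W F1.
  case: (ex_minnP exW) => k /andP[kn /asboolP Wk] kmin.
  have up : \forall z \near x, f z <= k.+1%:R / 2 ^+ n.
    have [kn'|kn'] := ltnP k (2 ^ n)%N.
      have [oV _ _ _ _] := slabF n k.+1 kn'.
      have : nbhs x (V n k.+1) by apply: open_nbhs_nbhs; split => //; exact: WV.
      by apply: filterS => z /(VW _ _ kn'); exact: fW.
    apply: nearW => z; apply: le_trans (f1 z) _.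
    by rewrite ler_pdivlMr // mul1r -natrX ler_nat ltnW.
  have dn : \forall z \near x, k%:R / 2 ^+ n - 1 / 2 ^+ n <= f z.
    case: k kn Wk kmin up => [|k] kn Wk kmin up.
      by apply: nearW => z; apply: le_trans (f0 z); rewrite mul0r sub0r oppr_le0 divr_ge0 // ltW.
    have nWk : ~ W n k x.
      move=> Wkx; suff : (k < k)%N by rewrite ltnn.
      by apply: kmin; rewrite (ltnW kn) /=; apply/asboolP.
    have [_ cW _ _ _] := slabF n k (ltnW kn).
    have : nbhs x (~` W n k) by apply: open_nbhs_nbhs; split => //; exact: closed_openC.
    apply: filterS => z nWz.
    by rewrite -mulrBl -natr1 addrK; apply: fnW => //; exact: ltnW.
  have fxu : f x <= k%:R / 2 ^+ n by exact: fW.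
  have fxd : k%:R / 2 ^+ n - 1 / 2 ^+ n <= f x by exact: nbhs_singleton dn.
  near=> z.
  have fzu : f z <= k.+1%:R / 2 ^+ n by near: z.
  have fzd : k%:R / 2 ^+ n - 1 / 2 ^+ n <= f z by near: z.
  have E1 : k.+1%:R / 2 ^+ n = k%:R / 2 ^+ n + 1 / 2 ^+ n :> R.
    by rewrite -mulrDl natr1.
  have E2 : 2 / 2 ^+ n = 1 / 2 ^+ n + 1 / 2 ^+ n :> R by rewrite -mulrDl.
  have i0 : 0 <= 1 / 2 ^+ n :> R by rewrite divr_ge0 // ltW.
  by rewrite ltr_distl; lra.
- by move=> x; rewrite f0 f1.
- move=> x y xy; apply: lbS => _ [n [k [kn Wy ->]]]; apply: fW => //.
  by have [_ _ _ dW _] := slabF n k kn; exact: dW Wy xy.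
- move=> x Ax; apply/eqP; rewrite eq_le f0 andbT.
  by have := @fW x 0%N 0%N isT; rewrite mul0r; apply; rewrite /W F0.
- move=> x Bx; apply/eqP; rewrite eq_le f1 /=.
  apply: lbS => _ [n [k [kn Wx ->]]].
  move: kn; rewrite leq_eqVlt => /orP[/eqP->|kn].
    by rewrite -natrX divff // pnatr_eq0 expn_eq0.
  have [_ _ kV] := FS n k kn.
  exfalso; have : V n (2 ^ n)%N x.
    have [kk|kk] := ltnP k.+1 (2 ^ n)%N; last first.
      have -> : (2 ^ n)%N = k.+1 by apply/eqP; rewrite eqn_leq kk kn.
      exact: kV.
    have pk : (0 < 2 ^ n)%N by rewrite expn_gt0.
    rewrite -(prednK pk); apply: WV; rewrite ?prednK //.
    by apply: WW Wx; rewrite ?leq_pred // -ltnS prednK.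
  by rewrite /V F1.
Unshelve. all: by end_near. Qed.

End PreorderUrysohn.

(** * Lyapunov functions *)

Lemma bounded_fun_leP (R : realType) (T : Type) (u : T -> R) :
  bounded_fun u <-> exists M, forall x, `|u x| <= M.
Proof.
split=> [[M [_ uM]]|[M uM]].
  by exists (M + 1) => x; apply: uM => //; rewrite ltrDl.
exists M; split; first exact: num_real.
by move=> N MN x _; apply: le_trans (uM x) _; exact: ltW.
Qed.

Lemma bounded_continuousP (R : realType) (X : topologicalType) (u : X -> R) :
  bounded_continuous u <-> continuous u /\ exists M, forall x, `|u x| <= M.
Proof. by split=> -[cu /bounded_fun_leP bu]. Qed.

Section UniformTopology.
Context {R : realType} {X : topologicalType}.

Lemma closed_uniformP (A : set (X -> R)) :
  closed (A : set {uniform X -> R}) <->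
  forall u, (forall e, 0 < e -> exists2 v, A v & forall x, `|u x - v x| < e) -> A u.
Proof.
split=> [cA u Au|Au u clu].
  apply: cA => B /uniform_nbhs [E [+ EB]]; rewrite -entourage_ballE => -[e /= e0 eE].
  have [v Av uv] := Au e e0.
  by exists v; split => //; apply: EB => y _; apply: eE; exact: uv.
apply: Au => e e0.
have [|v [Av uv]] := clu [set v : X -> R | forall x, `|u x - v x| < e].
  apply/uniform_nbhs; exists [set p | `|p.1 - p.2| < e]; split.
    by rewrite -entourage_ballE; exists e.
  by move=> v uv x; exact: uv.
by exists v.
Qed.

Lemma flow_unif_continuousP (phi : R -> X -> X) (u : X -> R) :
  flow_unif_continuous phi u <-> bounded_continuous u /\
  forall e, 0 < e -> exists2 d, 0 < d &
    forall s t x, `|s - t| < d -> `|u (phi s x) - u (phi t x)| < e.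
Proof.
split=> -[bu uu]; split => //.
  move=> e e0.
  have : entourage [set p : {uniform X -> R} * {uniform X -> R} |
      forall x : X, `|p.1 x - p.2 x| < e].
    rewrite uniform_entourage; exists [set p | `|p.1 - p.2| < e].
      by rewrite -entourage_ballE; exists e.
    by move=> p pe x; exact: pe.
  move=> /uu; rewrite /nbhs /= -entourage_ballE => -[d /= d0 dE]; exists d => // s t x st.
  by have := dE (s, t) st; apply.
move=> E; rewrite uniform_entourage => -[P + PE].
rewrite -entourage_ballE => -[e /= e0 eP].
have [d d0 du] := uu e e0.
apply: (@filterS _ entourage _ [set p : R * R | ball p.1 d p.2]).
  by move=> [s t] /= st; apply: PE => x _; apply: eP => /=; exact: du.
by rewrite -entourage_ballE; exists d.
Qed.

End UniformTopology.

Lemma lcsc_hausdorff_regular (X : topologicalType) :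
  lcsc_hausdorff X -> regular_space X.
Proof.
move=> [lc _ hX] x; have [C xC cC] := locally_compact_nbhs x lc.
exact: (compact_regular hX cC xC).
Qed.

Section LyapunovFunctions.
Context {R : realType} {X : topologicalType} (phi : R -> X -> X).
Context (hX : lcsc_hausdorff X) (hphi : is_flow phi).

Lemma lyapunov_GI (u : X -> R) : lyapunov phi u -> GI phi `<=` le_rel u.
Proof.
move=> [/bounded_continuousP[cu _] hu]; apply: chain_closure_min.
- have -> : le_rel u = (fun p : X * X => u p.2 - u p.1) @^-1` [set r | 0 <= r].
    by apply/seteqP; split=> p; rewrite /le_rel /= subr_ge0.
  apply: closed_preimage; last exact: closed_ge.
  move=> p; apply: cvgB; apply: (continuous_compose _ cu).
    exact: snd_cts.
  exact: fst_cts.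
- by move=> x y z; exact: le_trans.
- move=> [x y] [t] /=; rewrite in_itv /= => /andP[t0 _] ->.
  by rewrite /le_rel /= -{1}(flow0 hphi x); exact: hu.
Qed.

(** [f] increases along orbits but perhaps arbitrarily fast. In [g], the supremum of
    [f (phi s z) - s] over [0 <= s <= 1], the penalty of slope 1 limits the growth to 1 per unit of
    time, and the length 1 of the window matches the bound [f <= 1]. *)
Lemma lyapunov_smoothing (f : X -> R) (x y : X) :
    continuous f -> (forall z, 0 <= f z <= 1) ->
    (forall a b, GI phi (a, b) -> f a <= f b) -> f x = 1 -> f y = 0 ->
  exists L, [/\ lyapunov phi L, flow_unif_continuous phi L & L y < L x].
Proof.
move=> cf f01 isof fx fy.
have f1 z : f z <= 1 by case/andP: (f01 z).
have f0 z : 0 <= f z by case/andP: (f01 z).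
pose S z : set R := [set f (phi s z) - s | s in `[0, 1]].
pose g z : R := sup (S z).
have S0 z : S z (f z).
  by exists 0; [rewrite /= in_itv /= lexx ler01|rewrite (flow0 hphi) subr0].
have ubS z : ubound (S z) 1.
  move=> _ [s + <-]; rewrite /= in_itv /= => /andP[s0 _].
  by rewrite lerBlDr; apply: le_trans (f1 _) _; rewrite lerDl.
have gub z s : 0 <= s -> s <= 1 -> f (phi s z) - s <= g z.
  move=> s0 s1; apply: ub_le_sup; first by exists 1.
  by exists s => //; rewrite /= in_itv /= s0.
have glub z c : (forall s, 0 <= s -> s <= 1 -> f (phi s z) - s <= c) -> g z <= c.
  move=> h; apply: ge_sup; first by exists (f z).
  by move=> _ [s + <-]; rewrite /= in_itv /= => /andP[s0 s1]; exact: h.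
have fg z : f z <= g z by apply: ub_le_sup => //; exists 1.
have g1 z : g z <= 1 by apply: ge_sup => //; exists (f z).
have g0 z : 0 <= g z := le_trans (f0 z) (fg z).
have gmono t z : 0 <= t -> g z <= g (phi t z).
  move=> t0; apply: glub => s s0 s1; apply: le_trans (gub _ _ s0 s1).
  by rewrite lerD2r (flowC hphi); apply: isof; exact: GI_flow.
(* If [s + t <= 1], the term for [s] at [phi t z] is the term for [s + t] at [z] plus [t]. Otherwise
   it is at most [1 - s < t], and [g z >= 0]. *)
have glip t z : 0 <= t -> g (phi t z) <= g z + t.
  move=> t0; apply: glub => s s0 s1; rewrite -(flowD hphi).
  have [st|st] := leP (s + t) 1.
    by have := gub z _ (addr_ge0 s0 t0) st; lra.
  by have := f1 (phi (s + t) z); have := g0 z; lra.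
(* By the tube lemma [f (phi s z')] is close to [f (phi s z)] for all [s] in [[0, 1]] at once, so
   the suprema are close. *)
have cg : continuous g.
  move=> z; apply/cvgrPdist_lt => e e0.
  have e20 : 0 < e / 2 by rewrite divr_gt0.
  pose C : set (R * X) := [set p | `|f (phi p.1 z) - f (phi p.1 p.2)| < e / 2].
  have CT (s : R) : `[0, 1]%classic s -> nbhs (s, z) C.
    move=> _.
    have /(_ (s, z)) : continuous (fun p : R * X => f (phi p.1 z) - f (phi p.1 p.2)).
      move=> p; apply: cvgB.
        apply: (continuous_compose _ cf).
        exact: (continuous_compose (@fst_cts R X) (flow_orbit_cts hphi z)).
      exact: (continuous_compose (flow_cts2 hphi) cf).
    move=> /cvgrPdist_lt /(_ _ e20) /=; rewrite subrr.
    by apply: filterS => p; rewrite sub0r normrN.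
  have := compact_tube (segment_compact (a := 0 : R) (b := 1)) CT.
  apply: filterS => z' h.
  have {}h s : 0 <= s -> s <= 1 -> `|f (phi s z) - f (phi s z')| < e / 2.
    by move=> s0 s1; apply: (h s); rewrite /= in_itv /= s0.
  apply: (@le_lt_trans _ _ (e / 2)); last by lra.
  rewrite ler_distl; apply/andP; split.
    rewrite lerBlDr; apply: glub => s s0 s1.
    have := gub z s s0 s1; have := h s s0 s1; rewrite ltr_distl => /andP[]; lra.
  apply: glub => s s0 s1.
  have := gub z' s s0 s1; have := h s s0 s1; rewrite ltr_distl => /andP[]; lra.
have bg : bounded_continuous g.
  apply/bounded_continuousP; split => //; exists 1 => z.
  by rewrite ger0_norm.
have gst s t z : s <= t -> g (phi s z) <= g (phi t z) <= g (phi s z) + (t - s).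
  move=> st; have -> : phi t z = phi (t - s) (phi s z) by rewrite -(flowD hphi) subrK.
  by rewrite gmono ?glip // subr_ge0.
exists g; split.
- by split => // z s t /(gst _ _ z)/andP[].
- apply/flow_unif_continuousP; split => // e e0; exists e => // s t z.
  have [/(gst _ _ z)/andP[a b]|/ltW/(gst _ _ z)/andP[a b]] := leP s t;
    by rewrite !ltr_distl => /andP[? ?]; apply/andP; split; lra.
(* Strict separation survives: [f y = 0] keeps the terms at [y] below [1 / 2] for times less than
   some [d], and from [d] on the penalty keeps them below [1 - d]. *)
- apply: (@lt_le_trans _ _ 1); last by rewrite -fx.
  have /(_ 0)/cvgrPdist_lt/(_ (1 / 2)) : continuous (fun s => f (phi s y)).
    exact: (continuous_compose (flow_orbit_cts hphi y) cf).
  rewrite (flow0 hphi) fy divr_gt0 // => /(_ isT) /nbhs_ballP[d /= d0 hd].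
  apply: (@le_lt_trans _ _ (Num.max (1 / 2) (1 - d))); last first.
    by rewrite gt_max; apply/andP; split; lra.
  apply: glub => s s0 s1; rewrite le_max.
  have [sd|sd] := ltP s d.
    have /hd : ball 0 d s by rewrite /ball /= sub0r normrN ger0_norm.
    by rewrite /= sub0r normrN ger0_norm // => h; apply/orP; left; lra.
  by apply/orP; right; have := f1 (phi s y); lra.
Qed.

(** Urysohn's lemma is used for the predecessors of [y] and the successors of [x], two closed sets
    that are disjoint by transitivity. *)
Lemma lyapunov_separation (x y : X) : ~ GI phi (x, y) ->
  exists L, [/\ lyapunov phi L, flow_unif_continuous phi L & L y < L x].
Proof.
move=> nxy; have [lc sc hsX] := hX.
have down_cl : closed [set a | GI phi (a, y)].
  apply: (@closed_preimage _ _ (fun a => (a, y)) (GI phi)); last exact: GI_closed.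
  exact: pair_cts_l.
have up_cl : closed [set a | GI phi (x, a)].
  apply: (@closed_preimage _ _ (fun a => (x, a)) (GI phi)); last exact: GI_closed.
  exact: pair_cts_r.
have [|||f [cf f01 isof fA fB]] := @preorder_urysohn R X (GI phi)
  (lcsc_hausdorff_regular hX) lc sc (@GI_closed R X phi) (@GI_trans R X phi)
  (GI_refl hphi) _ _ down_cl up_cl.
- by move=> a b by' ab; exact: GI_trans ab by'.
- by move=> a b xa ab; exact: GI_trans xa ab.
- by move=> a [ay xa]; apply: nxy; exact: GI_trans xa ay.
apply: (lyapunov_smoothing cf f01 isof).
  by apply: fB; exact: GI_refl.
by apply: fA; exact: GI_refl.
Qed.

Lemma lyapunov_flow (u : X -> R) t : lyapunov phi u -> lyapunov phi (u \o phi t).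
Proof.
move=> [/bounded_continuousP[cu [M uM]] hu]; split.
  apply/bounded_continuousP; split; first exact: (continuous_compose (flow_cts hphi t) cu).
  by exists M => x; exact: uM.
move=> x s s' ss' /=; rewrite -!(flowD hphi); apply: hu; by rewrite lerD2l.
Qed.

Lemma flow_unif_continuous_flow (u : X -> R) t :
  flow_unif_continuous phi u -> flow_unif_continuous phi (u \o phi t).
Proof.
move=> /flow_unif_continuousP[/bounded_continuousP[cu [M uM]] hu].
apply/flow_unif_continuousP; split.
  apply/bounded_continuousP; split; first exact: (continuous_compose (flow_cts hphi t) cu).
  by exists M => x; exact: uM.
move=> e /hu[d d0 hd]; exists d => // s s' x ss' /=.
by rewrite -!(flowD hphi); apply: hd; rewrite opprD addrACA subrr add0r.
Qed.

Lemma flow_invariant_familyP (A : set (X -> R)) :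
  (forall t u, A u -> A (u \o phi t)) -> flow_invariant_family phi A.
Proof.
move=> hA t; apply/seteqP; split=> [_ [u Au <-]|u Au]; first exact: hA.
exists (u \o phi (- t)); first exact: hA.
by apply/funext => x /=; rewrite (flowK hphi).
Qed.

Lemma sufficient_lyapunov :
  sufficient phi (lyapunov phi `&` flow_unif_continuous phi).
Proof.
split; [by move=> u []|by move=> u []|].
apply/seteqP; split=> [[x y] h|p Gp u [lu _]]; last exact: lyapunov_GI.
apply: contrapT => /lyapunov_separation[L [lL uL]].
by rewrite ltNge => /negP; apply; exact: (h L).
Qed.

Lemma sufficient_orbit (A : set (X -> R)) : sufficient phi A ->
  let A' := [set u \o phi t | u in A & t in [set: R]] in
  sufficient phi A' /\ flow_invariant_family phi A'.
Proof.
move=> [lA uA AE] A'; split; first split.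
- by move=> _ [u Au [t _ <-]]; apply: lyapunov_flow; exact: lA.
- by move=> _ [u Au [t _ <-]]; apply: flow_unif_continuous_flow; exact: uA.
- apply/seteqP; split=> [p h|p Gp _ [u Au [t _ <-]]].
    rewrite -AE => u Au.
    have : A' (u \o phi 0) by exists u => //; exists 0.
    by move=> /h; rewrite /le_rel /= !(flow0 hphi).
  by apply: lyapunov_GI => //; apply: lyapunov_flow; exact: lA.
- apply: flow_invariant_familyP => s _ [u Au [t _ <-]].
  exists u => //; exists (t + s) => //.
  by apply/funext => x /=; rewrite (flowD hphi).
Qed.

End LyapunovFunctions.

(** * The Stone-Weierstrass theorem *)

Section CompactReal.
Context {R : realType} {Y : topologicalType}.
Implicit Types u v : Y -> R.

Lemma continuous_lt_nbhs u v y : continuous u -> continuous v -> u y < v y ->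
  \forall z \near y, u z < v z.
Proof.
move=> cu cv uv.
have cw : continuous (fun z => v z - u z).
  by move=> z; apply: cvgB; [exact: cv|exact: cu].
have oW : open [set z | 0 < v z - u z].
  exact: (open_preimage cw (@open_gt R 0)).
have : nbhs y [set z | 0 < v z - u z].
  by apply: open_nbhs_nbhs; split => //=; rewrite subr_gt0.
by apply: filterS => z /=; rewrite subr_gt0.
Qed.

Lemma continuous_normB u v : continuous u -> continuous v ->
  continuous (fun z => `|u z - v z|).
Proof. by move=> cu cv z; apply: cvg_norm; apply: cvgB; [exact: cu|exact: cv]. Qed.

Lemma compact_set_bounded (K : set Y) u : compact K -> continuous u ->
  exists2 M, 0 < M & forall y, K y -> `|u y| <= M.
Proof.
move=> cK cu.
apply: (compact_induction (P := fun S => exists2 M, 0 < M & forall y, S y -> `|u y| <= M) cK).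
- by exists 1.
- by move=> A B AB [M M0 h]; exists M => // y /AB; exact: h.
- move=> A B [M M0 h] [N N0 k]; exists (M + N); first exact: addr_gt0.
  by move=> y [/h|/k]; lra.
- move=> y _; exists [set z | `|u z| < `|u y| + 1].
    apply: (@continuous_lt_nbhs (fun z => `|u z|)); last by rewrite ltrDl.
      by move=> z; apply: cvg_norm; exact: cu.
    exact: cst_cts.
  exists (`|u y| + 1) => [|z /ltW //].
  by rewrite ltr_wpDl.
Qed.

Lemma compact_continuous_bounded u : compact [set: Y] -> continuous u ->
  exists2 M, 0 < M & forall y, `|u y| <= M.
Proof.
by move=> cY cu; have [M M0 h] := compact_set_bounded cY cu; exists M => // y; exact: h.
Qed.

End CompactReal.

(* A polynomial in [a ^+ 2] increasing to [a]; for [a = `|u y|] it exhibits [`|u|] as a uniform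
   limit of polynomials in [u]. *)
Fixpoint abs_approx (R : realType) (a : R) (n : nat) : R :=
  if n is m.+1 then abs_approx a m + (a ^+ 2 - abs_approx a m ^+ 2) / 2 else 0.

(** One step multiplies the error [a - s] by [1 - (a + s) / 2]. The induction runs on the bound
    [2 * a / (2 + n * a)] for the error, from which the last claim follows after cancelling [a]. *)
Lemma abs_approxP (R : realType) (a : R) (n : nat) : 0 <= a <= 1 ->
  [/\ 0 <= abs_approx a n, abs_approx a n <= a & n%:R * (a - abs_approx a n) <= 2].
Proof.
move=> /andP[a0 a1].
suff [s0 sa h] : [/\ 0 <= abs_approx a n, abs_approx a n <= a &
    (a - abs_approx a n) * (2 + n%:R * a) <= 2 * a].
  split => //; have [->|an0] := eqVneq a 0.
    have -> : abs_approx 0 n = 0 :> R by elim: n {s0 sa h} => //= n ->; lra.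
    by rewrite subrr mulr0.
  have ap : 0 < a by rewrite lt_def an0.
  rewrite -(ler_pM2r ap); apply: le_trans h.
  have : 0 <= a - abs_approx a n by rewrite subr_ge0.
  by move: (a - _) => d d0; nra.
elim: n => [|n [s0 sa h]] /=; first by split; nra.
set s := abs_approx a n in s0 sa h *.
have E : a - (s + (a ^+ 2 - s ^+ 2) / 2) = (a - s) * (1 - (a + s) / 2).
  by rewrite !expr2; field.
have d0 : 0 <= a - s by rewrite subr_ge0.
have e0 : 0 <= 1 - (a + s) / 2 by lra.
split.
- by apply: addr_ge0 => //; rewrite divr_ge0 // subr_ge0 ler_sqr.
- by rewrite -subr_ge0 E mulr_ge0.
- rewrite E; apply: le_trans h; rewrite -mulrA; apply: ler_wpM2l => //.
  have -> : n.+1%:R * a = n%:R * a + a by rewrite -natr1 mulrDl mul1r.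
  have m0 : 0 <= n%:R * a by rewrite mulr_ge0.
  move: (n%:R * a) m0 => m m0.
  have : 0 <= (a + s) * (m + a) by rewrite mulr_ge0 // addr_ge0.
  lra.
Qed.

(** The counterpart of [closed_subalgebra] meant for compact [Y], where continuous functions are
    bounded; closedness is spelled out as stability under uniform approximation. *)
Definition uniform_algebra (R : realType) (Y : topologicalType) (B : set (Y -> R)) :=
  [/\ forall u, B u -> continuous u, forall c, B (cst c),
      forall u v, B u -> B v -> B (u \+ v),
      forall u v, B u -> B v -> B (u \* v) &
      forall u, (forall e, 0 < e -> exists2 v, B v & forall y, `|u y - v y| < e) -> B u].

Section StoneWeierstrass.
Context {R : realType} {Y : topologicalType} (B : set (Y -> R)).
Context (cY : compact [set: Y]) (hB : uniform_algebra B).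
Implicit Types u v : Y -> R.

Let Bcts u : B u -> continuous u. Proof. by case: hB => + _ _ _ _; exact. Qed.
Let Bcst c : B (cst c). Proof. by case: hB. Qed.
Let BD u v : B u -> B v -> B (u \+ v). Proof. by case: hB => _ _ + _ _; exact. Qed.
Let BM u v : B u -> B v -> B (u \* v). Proof. by case: hB => _ _ _ + _; exact. Qed.

Lemma uniform_algebra_lin a b u v : B u -> B v -> B (fun y => a * u y + b * v y).
Proof. by move=> Bu Bv; exact: (BD (BM (Bcst a) Bu) (BM (Bcst b) Bv)). Qed.

Lemma uniform_algebra_abs u : B u -> B (fun y => `|u y|).
Proof.
move=> Bu; have [M M0 uM] := compact_continuous_bounded cY (Bcts Bu).
(* Rescaling brings [|w|] into [[0, 1]], the range of [abs_approxP]. *)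
pose w y := M^-1 * u y.
have Bw : B w by exact: (BM (Bcst _) Bu).
have Bs n : B (fun y => abs_approx `|w y| n).
  elim: n => [|n IH] /=; first exact: (Bcst 0).
  have := uniform_algebra_lin 1 1 IH (uniform_algebra_lin (2^-1) (- 2^-1) (BM Bw Bw) (BM IH IH)).
  congr B; apply/funext => y /=.
  by rewrite real_normK ?num_real // !expr2; field.
suff Bnw : B (fun y => `|w y|).
  suff -> : (fun y => `|u y|) = cst M \* (fun y => `|w y|) by exact: BM.
  apply/funext => y /=; by rewrite normrM normfV (gtr0_norm M0) mulVKf // gt_eqF.
case: hB => _ _ _ _; apply => e e0.
pose n := (Num.truncn (2 / e)).+1.
exists (fun y => abs_approx `|w y| n) => // y.
have w01 : 0 <= `|w y| <= 1.
  rewrite normr_ge0 /= normrM normfV (gtr0_norm M0) mulrC.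
  by rewrite ler_pdivrMr // mul1r.
have [s0 sw h] := abs_approxP n w01.
rewrite ger0_norm ?subr_ge0 //.
have n0 : 0 < n%:R :> R by rewrite ltr0n.
rewrite -(ltr_pM2l n0); apply: le_lt_trans h _.
by rewrite -ltr_pdivrMr // truncnS_gt.
Qed.

Lemma uniform_algebra_max u v : B u -> B v -> B (fun y => Num.max (u y) (v y)).
Proof.
move=> Bu Bv.
have := uniform_algebra_lin 2^-1 2^-1 (BD Bu Bv)
  (uniform_algebra_abs (uniform_algebra_lin 1 (-1) Bu Bv)).
congr B; apply/funext => y /=.
by rewrite maxr_absE mul1r mulN1r; field.
Qed.

Lemma uniform_algebra_min u v : B u -> B v -> B (fun y => Num.min (u y) (v y)).
Proof.
move=> Bu Bv.
have := uniform_algebra_lin 2^-1 (- 2^-1) (BD Bu Bv)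
  (uniform_algebra_abs (uniform_algebra_lin 1 (-1) Bu Bv)).
congr B; apply/funext => y /=.
by rewrite minr_absE mul1r mulN1r; field.
Qed.

(** Members of [B] interpolate [v] at any two points. Finite minima of interpolants through a fixed
    [y] stay below [v + e] everywhere and equal [v] at [y]; finite maxima of these also stay above
    [v - e]. *)
Theorem stone_weierstrass :
  (forall y z, y <> z -> exists2 u, B u & u y <> u z) ->
  forall v, continuous v -> B v.
Proof.
move=> sep v cv; case: (hB) => _ _ _ _; apply => e e0.
have interp y z : exists g, [/\ B g, g y = v y & g z = v z].
  have [->|yz] := eqVneq y z; first by exists (cst (v z)).
  have [u Bu uyz] := sep y z (elimN eqP yz).
  have uzy : u z - u y != 0 by rewrite subr_eq0 eq_sym; apply/eqP.
  pose b := (v z - v y) / (u z - u y).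
  exists (fun w => 1 * cst (v y - b * u y) w + b * u w); split.
  - exact: uniform_algebra_lin.
  - by rewrite /= mul1r subrK.
  - have -> : 1 * (v y - b * u y) + b * u z = v y + b * (u z - u y) by ring.
    by rewrite /b divfK // addrC subrK.
have vle : continuous (fun w => v w + e).
  by move=> w; apply: cvgD; [exact: cv|exact: cvg_cst].
have vge : continuous (fun w => v w - e).
  by move=> w; apply: cvgB; [exact: cv|exact: cvg_cst].
have above y : exists g, [/\ B g, g y = v y & forall z, [set: Y] z -> g z < v z + e].
  apply: (compact_induction
    (P := fun S => exists g, [/\ B g, g y = v y & forall z, S z -> g z < v z + e]) cY).
  - by exists (cst (v y)).
  - by move=> S T ST [g [Bg gy h]]; exists g; split => // z /ST; exact: h.
  - move=> S T [g [Bg gy h]] [g' [Bg' gy' h']].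
    exists (fun w => Num.min (g w) (g' w)); split.
    + exact: uniform_algebra_min.
    + by rewrite gy gy' minxx.
    + by move=> z [/h|/h'] hz; rewrite gt_min hz ?orbT.
  - move=> z _; have [g [Bg gy gz]] := interp y z.
    exists [set w | g w < v w + e].
      by apply: continuous_lt_nbhs => //; [exact: Bcts|rewrite gz ltrDl].
    by exists g.
suff [g [Bg gv vg]] : exists g, [/\ B g, forall z, g z < v z + e &
    forall z, [set: Y] z -> v z - e < g z].
  exists g => // z; rewrite distrC ltr_distl gv andbT; exact: vg.
apply: (compact_induction (P := fun S => exists g, [/\ B g,
   forall z, g z < v z + e & forall z, S z -> v z - e < g z]) cY).
(* Even over the empty set the function must be below [v + e] on all of [Y]; a constant lower bound
   of [v] serves. *)
- have [M M0 vM] := compact_continuous_bounded cY cv.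
  exists (cst (- M)); split => // z /=.
  by have := vM z; rewrite ler_norml /cst => /andP[? _]; lra.
- by move=> S T ST [g [Bg gv h]]; exists g; split => // z /ST; exact: h.
- move=> S T [g [Bg gv h]] [g' [Bg' gv' h']].
  exists (fun w => Num.max (g w) (g' w)); split.
  + exact: uniform_algebra_max.
  + by move=> z; rewrite gt_max gv gv'.
  + by move=> z [/h|/h'] hz; rewrite lt_max hz ?orbT.
- move=> y _; have [g [Bg gy gv]] := above y.
  exists [set w | v w - e < g w].
    by apply: continuous_lt_nbhs => //; [exact: Bcts|rewrite gy ltrBlDr ltrDl].
  by exists g; split => // z; exact: gv.
Qed.

End StoneWeierstrass.

Lemma uniform_algebra_continuous (R : realType) (Y : topologicalType) :
  uniform_algebra [set v : Y -> R | continuous v].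
Proof.
split => //.
- by move=> c; exact: cst_cts.
- by move=> u v cu cv x; apply: cvgD; [exact: cu|exact: cv].
- by move=> u v cu cv x; apply: cvgM; [exact: cu|exact: cv].
- move=> u hu y; apply/cvgrPdist_lt => e e0.
  have e3 : 0 < e / 3 by rewrite divr_gt0.
  have [v cv uv] := hu _ e3.
  have /cvgrPdist_lt/(_ _ e3) : v z @[z --> y] --> v y by exact: cv.
  apply: filterS => z.
  have := uv y; have := uv z; rewrite !ltr_distl => /andP[? ?] /andP[? ?] /andP[? ?].
  by apply/andP; split; lra.
Qed.

Lemma uniform_algebra_equalizer (R : realType) (Y : topologicalType) (y z : Y) :
  uniform_algebra [set v : Y -> R | continuous v /\ v y = v z].
Proof.
have [_ Ac AD AM Acl] := uniform_algebra_continuous R Y.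
split.
- by move=> u [].
- by move=> c; split => //; exact: Ac.
- by move=> u v [cu uyz] [cv vyz]; split; [exact: AD|rewrite /= uyz vyz].
- by move=> u v [cu uyz] [cv vyz]; split; [exact: AM|rewrite /= uyz vyz].
- move=> u hu; split.
    by apply: Acl => e /hu[v [cv _] uv]; exists v.
  apply/eqP; rewrite -subr_eq0 -normr_le0; apply/ler_addgt0Pr => e e0.
  have e2 : 0 < e / 2 by rewrite divr_gt0.
  have [v [cv vyz] uv] := hu _ e2.
  have := uv y; have := uv z; rewrite vyz add0r ler_norml !ltr_distl.
  by move=> /andP[? ?] /andP[? ?]; apply/andP; split; lra.
Qed.

(** * Compactifications *)

Lemma completely_regular_separation (R : realType) (T : topologicalType)
    (x : T) (C : set T) :
  completely_regular_space T -> closed C -> ~ C x ->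
  exists f : T -> R, [/\ continuous f, forall y, 0 <= f y <= 1, f x = 1 &
    forall y, C y -> f y = 0].
Proof.
move=> crT cC nCx.
have /(uniform_separatorP (R := R))[f [cf f01 fx fC]] := crT x C cC nCx.
exists (fun y => 1 - f y); split.
- by move=> y; apply: cvgB; [exact: cvg_cst|exact: cf].
- move=> y; have : `[0, 1]%classic (f y) by apply: f01; exists y.
  by rewrite /= in_itv /= => /andP[? ?]; apply/andP; split; lra.
- by have -> : f x = 0 by [apply: fx; exists x]; rewrite subr0.
- by move=> y Cy; have -> : f y = 1 by [apply: fC; exists y]; rewrite subrr.
Qed.

Section Embedding.
Context {X Y : topologicalType} (i : X -> Y) (ei : topological_embedding i).

Lemma embedding_inj : injective i. Proof. by case: ei. Qed.

Lemma embedding_continuous : continuous i.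
Proof. by apply/continuousP => V oV; apply/ei.2; exists V. Qed.

Lemma embedding_nbhs (x : X) (U : set X) : nbhs x U ->
  exists V, [/\ open V, V (i x) & i @^-1` V `<=` U].
Proof.
rewrite nbhsE => -[W [oW Wx] WU].
by have /ei.2[V oV WV] := oW; exists V; split => //; rewrite -?WV //;
  move: Wx; rewrite WV.
Qed.

Lemma embedding_compact_preimage (C : set Y) :
  compact C -> C `<=` range i -> compact (i @^-1` C).
Proof.
move=> cC Ci F PF FC.
have [|y [Cy cl]] := cC (i @ F) _; first exact: FC.
have [x _ xy] := Ci _ Cy; rewrite -xy in Cy cl.
exists x; split => // A U FA xU.
have [V [oV Vx VU]] := embedding_nbhs xU.
have [|_ [[a Aa <-] Va]] := cl (i @` A) V _ (open_nbhs_nbhs (conj oV Vx)).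
  by move: (FA); rewrite /fmap /=; apply: filterS; exact: preimage_image.
by exists a; split => //; exact: VU.
Qed.

End Embedding.

Section CompactificationFacts.
Context {R : realType} {X Y : topologicalType} (i : X -> Y).
Context (hX : lcsc_hausdorff X) (hi : proper_compactification i).

Lemma compactification_compact : compact [set: Y]. Proof. by case: hi. Qed.
Lemma compactification_hausdorff : hausdorff_space Y. Proof. by case: hi. Qed.
Lemma compactification_embedding : topological_embedding i. Proof. by case: hi. Qed.

Let cY := compactification_compact.
Let hY := compactification_hausdorff.
Let ei := compactification_embedding.
Let ci : continuous i := embedding_continuous ei.

Lemma compactification_closed_ind (C : set Y) :
  closed C -> (forall x, C (i x)) -> forall y, C y.
Proof.
move=> cC Ci y; apply: contrapT => nCy.
have [_ _ _ dn] := hi.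
have [|z [nCz [x _ xz]]] := dn (~` C) _ (closed_openC cC); first by exists y.
by apply: nCz; rewrite -xz.
Qed.

Lemma compactification_le (u v : Y -> R) : continuous u -> continuous v ->
  (forall x, u (i x) <= v (i x)) -> forall y, u y <= v y.
Proof.
move=> cu cv; apply: (@compactification_closed_ind [set y | u y <= v y]).
have -> : [set y | u y <= v y] = (fun y => v y - u y) @^-1` [set r | 0 <= r].
  by apply/seteqP; split=> y; rewrite /= subr_ge0.
apply: closed_preimage; last exact: closed_ge.
by move=> y; apply: cvgB; [exact: cv|exact: cu].
Qed.

Lemma compactification_eq (u v : Y -> R) : continuous u -> continuous v ->
  u \o i = v \o i -> u = v.
Proof.
move=> cu cv uv; apply/funext => y.
apply/eqP; rewrite eq_le; apply/andP; split; apply: compactification_le => // x;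
  by have := congr1 (@^~ x) uv; rewrite /= => ->.
Qed.

(** For a compact neighbourhood [C] of [x], some open [V] around [i x] meets the range only inside
    the image of [C]. That image is closed, so density puts all of [V] into it. *)
Lemma compactification_open : open (range i).
Proof.
rewrite openE => _ [x _ <-].
have [lc _ _] := hX; have [C xC cC] := locally_compact_nbhs x lc.
have [V [oV Vx VC]] := embedding_nbhs ei xC.
have ciC : closed (i @` C).
  apply: (compact_closed hY); apply: continuous_compact => //.
  exact: continuous_subspaceT.
rewrite /interior; apply: (@filterS _ _ _ V); last exact: open_nbhs_nbhs.
move=> y Vy; suff [//|[a _ <-]] : (~` V `|` i @` C) y by exists a.
apply: (@compactification_closed_ind (~` V `|` i @` C)).
  by apply: closedU => //; exact: open_closedC.
move=> a; have [Va|] := pselect (V (i a)); last by left.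
by right; exists a => //; exact: VC.
Qed.

Lemma compactification_remainder_compact : compact (~` range i).
Proof.
rewrite -[X in compact X]setTI; apply: compact_closedI => //.
exact: open_closedC compactification_open.
Qed.

(** Extension by 0 is continuous at a remainder point because the image of the support is compact,
    hence closed in [Y]. *)
Lemma compactly_supported_extension (f : X -> R) : compactly_supported f ->
  exists v : Y -> R, [/\ continuous v, v \o i = f & forall y, ~ range i y -> v y = 0].
Proof.
move=> [cf cs].
pose v y := if pselect (exists x, i x = y) is left h then f (projT1 (cid h)) else 0.
have vi x : v (i x) = f x.
  rewrite /v; case: pselect => [h|[]]; last by exists x.
  by case: cid => /= a /(embedding_inj ei) ->.
have v0 y : ~ range i y -> v y = 0.
  rewrite /v; case: pselect => [h|//] ny; exfalso; apply: ny.
  by case: h => a <-; exists a.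
exists v; split => //; last by apply/funext => x; rewrite /= vi.
move=> y; have [[x _ <-]|ny] := pselect (range i y); apply/cvgrPdist_lt => e e0.
  have /cvgrPdist_lt/(_ e e0) : f z @[z --> x] --> f x by exact: cf.
  move=> /(embedding_nbhs ei)[V [oV Vx VC]].
  have : nbhs (i x) (V `&` range i).
    apply: open_nbhs_nbhs; split; last by split => //; exists x.
    by apply: openI => //; exact: compactification_open.
  apply: filterS => z [Vz [a _ az]].
  by rewrite -az in Vz *; rewrite !vi; exact: VC.
have cK : closed (i @` closure [set x | f x != 0]).
  apply: (compact_closed hY); apply: continuous_compact => //.
  exact: continuous_subspaceT.
have : nbhs y (~` (i @` closure [set x | f x != 0])).
  apply: open_nbhs_nbhs; split; first exact: closed_openC.
  by move=> [a _ ay]; apply: ny; exists a.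
apply: filterS => z nz; rewrite (v0 y ny).
suff -> : v z = 0 by rewrite subrr normr0.
have [[a _ az]|] := pselect (range i z); last exact: v0.
rewrite -az vi; apply/eqP/negPn/negP => fa; apply: nz; exists a => //.
exact: subset_closure.
Qed.

(** Only closedness needs work. A uniform limit [u] of traces is extended by the supremum [v] of all
    [g - e] with [g] in [B] within [e] of [u] on [X]. By density each [g' - e'] is below each
    [g + e] on all of [Y], so [v] is within [e] of [g]. *)
Lemma uniform_algebra_trace (B : set (Y -> R)) : uniform_algebra B ->
  closed_subalgebra [set v \o i | v in B].
Proof.
move=> [Bc Bcst BD BM Bcl]; split.
- move=> _ [v /Bc cv <-]; apply/bounded_continuousP; split.
    exact: (continuous_compose ci cv).
  have [M _ vM] := compact_continuous_bounded cY cv.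
  by exists M => x; exact: vM.
- by move=> c; exists (cst c) => //; exact: Bcst.
- by move=> _ _ [u Bu <-] [v Bv <-]; exists (u \+ v) => //; exact: BD.
- by move=> _ _ [u Bu <-] [v Bv <-]; exists (u \* v) => //; exact: BM.
apply/closed_uniformP => u hu.
pose near_u (g : Y -> R) e := [/\ B g, 0 < e & forall x, `|u x - g (i x)| < e].
pose S y : set R := [set r | exists g e, near_u g e /\ r = g y - e].
pose v y := sup (S y).
have cross g e g' e' y : near_u g e -> near_u g' e' -> g' y - e' <= g y + e.
  move=> [Bg e0 ug] [Bg' e0' ug'].
  apply: (@compactification_le (fun y => g' y - e') (fun y => g y + e)).
  - by move=> z; apply: cvgB; [exact: Bc|exact: cvg_cst].
  - by move=> z; apply: cvgD; [exact: Bc|exact: cvg_cst].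
  - move=> x; have := ug x; have := ug' x; rewrite !ltr_distl.
    by move=> /andP[? ?] /andP[? ?]; lra.
have vg g e y : near_u g e -> `|v y - g y| <= e.
  move=> ge; rewrite ler_distl; apply/andP; split.
    apply: ub_le_sup; last by exists g, e.
    by exists (g y + e) => _ [g' [e' [ge' ->]]]; exact: cross ge ge'.
  apply: ge_sup; first by exists (g y - e), g, e.
  by move=> _ [g' [e' [ge' ->]]]; exact: cross ge ge'.
have ex_near e : 0 < e -> exists g, near_u g e.
  by move=> e0; have [_ [g Bg <-] ug] := hu e e0; exists g.
exists v.
  apply: Bcl => e e0; have e2 : 0 < e / 2 by rewrite divr_gt0.
  have [g ge] := ex_near _ e2; exists g; first by case: ge.
  by move=> y; apply: le_lt_trans (vg _ _ y ge) _; lra.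
apply/funext => x /=; apply/eqP; rewrite -subr_eq0 -normr_le0.
apply/ler_addgt0Pr => e e0; have e2 : 0 < e / 2 by rewrite divr_gt0.
have [g ge] := ex_near _ e2; have := vg _ _ (i x) ge; have [_ _ /(_ x)] := ge.
rewrite add0r ltr_distl !ler_distl.
by move=> /andP[? ?] /andP[? ?]; apply/andP; split; lra.
Qed.

Lemma extendable_functionsE :
  extendable_functions i = [set v \o i | v in [set v : Y -> R | continuous v]].
Proof.
apply/seteqP; split=> [u [_ [v cv vu]]|_ [v cv <-]]; first by exists v.
split; last by exists v.
have [h _ _ _ _] := uniform_algebra_trace (uniform_algebra_continuous R Y).
by apply: h; exists v.
Qed.

Lemma extendable_closed_subalgebra : closed_subalgebra (@extendable_functions R _ _ i).
Proof.
rewrite extendable_functionsE; apply: uniform_algebra_trace.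
exact: uniform_algebra_continuous.
Qed.

Lemma compactification_separation (y z : Y) : y <> z ->
  exists2 v : Y -> R, continuous v & v y <> v z.
Proof.
move=> yz.
have crY : completely_regular_space Y.
  apply: (@normal_completely_regular R).
    exact: compact_normal.
  exact: hausdorff_accessible.
have [|v [cv _ vy vz]] := completely_regular_separation R (x := y) (C := [set z]) crY _ yz.
  exact: (accessible_closed_set1 (hausdorff_accessible hY)).
by exists v => //; rewrite vy vz => [/eqP|//]; rewrite oner_eq0.
Qed.

(** If every generator extended with equal values at [y] and [z], the functions with this property
    would trace a closed subalgebra containing [A], hence all extendable functions; but continuous
    functions separate points of [Y]. *)
Lemma generator_separation (A : set (X -> R)) (y z : Y) :
  extendable_functions i = smallest closed_subalgebra A -> y <> z ->
  exists v : Y -> R, [/\ continuous v, A (v \o i) & v y <> v z].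
Proof.
move=> extE yz; apply: contrapT => nsep.
have [w cw wyz] := compactification_separation yz; apply: wyz.
pose B := [set v : Y -> R | continuous v /\ v y = v z].
have AB : A `<=` [set v \o i | v in B].
  move=> u Au; have : extendable_functions i u.
    by rewrite extE => C [_]; exact.
  rewrite extendable_functionsE => -[v cv vu]; exists v => //; split => //.
  by apply: contrapT => vyz; apply: nsep; exists v; rewrite vu.
have : extendable_functions i (w \o i) by rewrite extendable_functionsE; exists w.
rewrite extE => /(_ _ (conj (uniform_algebra_trace (uniform_algebra_equalizer R y z)) AB)).
by move=> [v [cv vyz] /(compactification_eq cv cw) <-].
Qed.

End CompactificationFacts.

(** * The extended flow *)

Section Barrier.
Context {R : realType} {Y : topologicalType} (psi : R -> Y -> Y).
Context (cY : compact [set: Y]) (hpsi : is_flow psi).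

(** Otherwise the times in [[0, t]] at which the orbit is in [U] would form a nonempty, relatively
    open and closed set, hence all of the segment. *)
Lemma orbit_crosses_boundary (U : set Y) (a : Y) (t : R) : open U -> 0 <= t ->
  U a -> ~ closure U (psi t a) ->
  exists s, [/\ 0 <= s, s <= t & (closure U `\` U) (psi s a)].
Proof.
move=> oU t0 Ua nUb; apply: contrapT => ncross.
have UE s : 0 <= s -> s <= t -> closure U (psi s a) -> U (psi s a).
  by move=> s0 st clU; apply: contrapT => nU; apply: ncross; exists s.
have co := flow_orbit_cts hpsi a.
have : `[0, t]%classic `&` (psi^~ a @^-1` U) = `[0, t]%classic.
  apply: (@segment_connected R 0 t).
  - by exists 0; split => /=; [rewrite in_itv /= lexx|rewrite (flow0 hpsi)].
  - by exists (psi^~ a @^-1` U) => //; exact: open_preimage.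
  - exists (psi^~ a @^-1` closure U).
      by apply: closed_preimage => //; exact: closed_closure.
    apply/seteqP; split=> s [st Us]; split => //; first exact: subset_closure.
    by move: st; rewrite /= in_itv /= => /andP[s0 st]; exact: UE.
move=> /seteqP[_ /(_ t)]; rewrite /= in_itv /= t0 lexx => /(_ isT)[_ Ut].
by apply: nUb; exact: subset_closure.
Qed.

(** The relation [via] is closed as a projection along the compact boundary. In a composite whose
    middle point is in [closure U], that point is either on the boundary, and then a crossing point,
    or in [U], and then the second pair decides. *)
Lemma GI_crosses_boundary (U : set Y) (a b : Y) : open U ->
  GI psi (a, b) -> U a -> ~ closure U b ->
  exists c, [/\ (closure U `\` U) c, GI psi (a, c) & GI psi (c, b)].
Proof.
move=> oU.
pose bd := closure U `\` U.
have cbd : compact bd.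
  rewrite -[bd]setTI; apply: compact_closedI => //.
  by apply: closedI; [exact: closed_closure|exact: open_closedC].
pose via : set (Y * Y) := [set p | exists2 c, bd c & GI psi (p.1, c) /\ GI psi (c, p.2)].
pose h : set (Y * Y) := GI psi `&` (fst @^-1` (~` U) `|` snd @^-1` closure U `|` via).
suff : GI psi `<=` h.
  move=> /[apply] -[_ [[//|//]|[c bc [ac cb]]]] Ua nUb.
  by exists c.
apply: chain_closure_min.
- apply: closedI; first exact: GI_closed.
  apply: closedU; first apply: closedU.
  + by apply: closed_preimage; [exact: fst_cts|exact: open_closedC].
  + by apply: closed_preimage; [exact: snd_cts|exact: closed_closure].
  + pose C : set (Y * (Y * Y)) := [set q | GI psi (q.2.1, q.1) /\ GI psi (q.1, q.2.2)].
    apply: (compact_projection cbd (C := C)).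
    apply: closedI.
      apply: (@closed_preimage _ _ (fun q : Y * (Y * Y) => (q.2.1, q.1)) (GI psi)).
        apply: continuous_pair; last exact: fst_cts.
        exact: (continuous_compose (@snd_cts _ _) (@fst_cts _ _)).
      exact: GI_closed.
    apply: (@closed_preimage _ _ (fun q : Y * (Y * Y) => (q.1, q.2.2)) (GI psi)).
      apply: continuous_pair; first exact: fst_cts.
      exact: (continuous_compose (@snd_cts _ _) (@snd_cts _ _)).
    exact: GI_closed.
- move=> x y z [xy hxy] [yz hyz]; split; first exact: GI_trans xy yz.
  case: hxy => [[nUx|/= clUy]|[c bc [xc cy]]].
  + by left; left.
  + case: hyz => [[/= nUy|clUz]|[c bc [yc cz]]].
    * by right; exists y.
    * by left; right.
    * by right; exists c => //; split => //; exact: GI_trans xy yc.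
  + by right; exists c => //; split => //; exact: GI_trans cy yz.
- move=> [x y] xy; split; first exact: sub_chain_closure.
  move: xy => [t /=]; rewrite in_itv /= => /andP[t0 _] ->.
  have [Ux|nUx] := pselect (U x); last by left; left.
  have [Uy|nUy] := pselect (closure U (psi t x)); first by left; right.
  have [s [s0 st bs]] := orbit_crosses_boundary oU t0 Ux nUy.
  right; exists (psi s x) => //; split => /=; first exact: GI_flow.
  have -> : psi t x = psi (t - s) (psi s x) by rewrite -(flowD hpsi) subrK.
  by apply: GI_flow => //; rewrite subr_ge0.
Qed.

End Barrier.

Section FlowOnCompactification.
Context {R : realType} {X Y : topologicalType} (phi : R -> X -> X) (i : X -> Y)
  (psi : R -> Y -> Y).
Context (hphi : is_flow phi) (hi : proper_compactification i)
  (he : flow_extension phi i psi).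

Let hpsi : is_flow psi. Proof. by case: he. Qed.
Let psiE t x : psi t (i x) = i (phi t x). Proof. by case: he. Qed.
Let cY := compactification_compact hi.
Let hY := compactification_hausdorff hi.
Let ei := compactification_embedding hi.
Let ci : continuous i := embedding_continuous ei.

Lemma GI_trace_sub : GI phi `<=` rel_trace i (GI psi).
Proof.
apply: chain_closure_min.
- apply: (@closed_preimage _ _ (fun p : X * X => (i p.1, i p.2)) (GI psi)).
    apply: continuous_pair.
      exact: (continuous_compose (@fst_cts _ _) ci).
    exact: (continuous_compose (@snd_cts _ _) ci).
  exact: GI_closed.
- by move=> x y z; exact: GI_trans.
- move=> [x y] [t /=]; rewrite in_itv /= => t01 ->.
  by rewrite /rel_trace /= -psiE; exact: GI_small.
Qed.

(** The tube lemma over the compact [Y] gives a bound on times near 0 valid at every point; starting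
    from [psi s (i x)], it covers all pairs of close times. *)
Lemma flow_extension_compactification : flow_compactification phi i.
Proof.
split => //; rewrite extendable_functionsE //.
  move=> _ [v cv <-]; apply/flow_unif_continuousP; split.
    have : extendable_functions i (v \o i) by rewrite extendable_functionsE //; exists v.
    by case.
  move=> e e0.
  pose C : set (Y * R) := [set p | `|v p.1 - v (psi p.2 p.1)| < e].
  have C0 y : [set: Y] y -> nbhs (y, 0) C.
    move=> _; apply: (@continuous_lt_nbhs _ _
      (fun p : Y * R => `|v p.1 - v (psi p.2 p.1)|) (fun=> e)).
    - move=> p; apply: cvg_norm; apply: cvgB.
        exact: (continuous_compose (@fst_cts _ _) cv).
      apply: (continuous_compose _ cv).
      apply: (@continuous_compose _ _ _ (fun p : Y * R => (p.2, p.1))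
        (fun q : R * Y => psi q.1 q.2)); last exact: flow_cts2.
      by apply: continuous_pair; [exact: snd_cts|exact: fst_cts].
    - exact: cst_cts.
    - by rewrite /= (flow0 hpsi) subrr normr0.
  have /nbhs_ballP[d /= d0 hd] := compact_tube cY C0.
  exists d => // s t x st.
  have /hd/(_ (psi s (i x)) I) : ball 0 d (t - s).
    by rewrite /ball /= sub0r normrN distrC.
  by rewrite /C /= -(flowD hpsi) subrK !psiE.
apply: flow_invariant_familyP => // t _ [v cv <-]; exists (v \o psi t).
  exact: (continuous_compose (flow_cts hpsi t) cv).
by apply/funext => x /=; rewrite psiE.
Qed.

Lemma remainder_flow t y : ~ range i y -> ~ range i (psi t y).
Proof.
move=> ny [x _ xy]; apply: ny; exists (phi (- t) x) => //.
by rewrite -psiE xy (flowK hpsi).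
Qed.

Lemma remainder_invariant t : psi t @` (~` range i) = ~` range i.
Proof.
apply/seteqP; split=> [_ [y ny <-]|y ny]; first exact: remainder_flow.
by exists (psi (- t) y); [exact: remainder_flow|rewrite (flowNK hpsi)].
Qed.

Lemma lyapunov_extension (v : Y -> R) : continuous v ->
  lyapunov phi (v \o i) -> lyapunov psi v.
Proof.
move=> cv [_ hv]; split.
  apply/bounded_continuousP; split => //.
  by have [M _ vM] := compact_continuous_bounded cY cv; exists M.
move=> y s t st; apply: (compactification_le hi (u := fun y => v (psi s y))
  (v := fun y => v (psi t y))).
- exact: (continuous_compose (flow_cts hpsi s) cv).
- exact: (continuous_compose (flow_cts hpsi t) cv).
- by move=> x; rewrite !psiE; exact: hv.
Qed.

End FlowOnCompactification.

(** * Properties of a Lyapunov function compactification *)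

Section LyapunovCompactification.
Context {R : realType} {X Y : topologicalType} (phi : R -> X -> X) (i : X -> Y)
  (psi : R -> Y -> Y) (L : set (X -> R)).
Context (hX : lcsc_hausdorff X) (hphi : is_flow phi) (hi : proper_compactification i)
  (he : flow_extension phi i psi) (sL : sufficient phi L)
  (extE : extendable_functions i = smallest closed_subalgebra (L `|` compactly_supported)).

Let hpsi : is_flow psi. Proof. by case: he. Qed.
Let psiE t x : psi t (i x) = i (phi t x). Proof. by case: he. Qed.
Let cY := compactification_compact hi.
Let hY := compactification_hausdorff hi.
Let ei := compactification_embedding hi.
Let ci : continuous i := embedding_continuous ei.
Let hsX : hausdorff_space X. Proof. by case: hX. Qed.

Let Llyap v : continuous v -> L (v \o i) -> lyapunov psi v.
Proof.
by move=> cv Lv; apply: (lyapunov_extension hi he) => //; case: sL => + _ _; exact.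
Qed.

(** Each member of [L] extends to a Lyapunov function of [psi], which respects [GI psi]; on [X]
    sufficiency turns these inequalities back into [GI phi]. *)
Lemma GI_trace : rel_trace i (GI psi) = GI phi.
Proof.
apply/seteqP; split; last exact: GI_trace_sub.
move=> [x y] xy; have [_ _ <-] := sL => u Lu.
have : extendable_functions i u by rewrite extE => C [_]; apply; left.
rewrite extendable_functionsE // => -[v cv vu].
have lv : lyapunov psi v by apply: Llyap => //; rewrite vu.
by have := lyapunov_GI hpsi lv xy; rewrite /le_rel /= -vu.
Qed.

Lemma GIi x y : GI psi (i x, i y) <-> GI phi (x, y).
Proof. by rewrite -GI_trace. Qed.

Lemma GJi x y : GJ psi (i x, i y) <-> GJ phi (x, y).
Proof. by rewrite GJP // GJP // psiE GIi. Qed.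

Lemma GJ_trace : rel_trace i (GJ psi) = GJ phi.
Proof. by apply/seteqP; split=> -[x y] /GJi. Qed.

Lemma remainder_GI_antisym y z : ~ range i y -> ~ range i z ->
  GI psi (y, z) -> GI psi (z, y) -> y = z.
Proof.
move=> ny nz yz zy; apply: contrapT => /(generator_separation hi extE).
move=> [v [cv [Lv|Cv]]]; apply.
  have lv := Llyap cv Lv.
  apply/eqP; rewrite eq_le; apply/andP; split.
    exact: (lyapunov_GI hpsi lv yz).
  exact: (lyapunov_GI hpsi lv zy).
have [w [cw wv w0]] := compactly_supported_extension hX hi Cv.
by rewrite -(compactification_eq hi cw cv wv) !w0.
Qed.

(** For [s] in [[0, 1]], [y] precedes [psi s y], which precedes [psi 1 y], which precedes [y] by
    recurrence. Antisymmetry on the remainder gives [psi s y = y], and small times generate all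
    others. *)
Lemma remainder_recurrent_fixed :
  ~` range i `&` rel_diag (GJ psi) `<=` fixed_points psi.
Proof.
move=> y [ny /(GJP hpsi hY) yy].
have small s : 0 <= s <= 1 -> psi s y = y.
  move=> /andP[s0 s1]; apply: remainder_GI_antisym => //.
  - exact: (remainder_flow he).
  - apply: (GI_trans _ yy); have -> : psi 1 y = psi (1 - s) (psi s y).
      by rewrite -(flowD hpsi) subrK.
    by apply: GI_flow => //; rewrite subr_ge0.
  - exact: GI_flow.
move=> t /nat_fraction[n [t' [t01 ->]]].
elim: n => [|n IH]; first by rewrite mul0r (flow0 hpsi).
by rewrite -natr1 mulrDl mul1r (flowD hpsi) small.
Qed.

Lemma rel_class_trace x : i @^-1` rel_class (GI psi) (i x) = rel_class (GI phi) x.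
Proof.
apply/seteqP; split=> y [xy yx]; split; [exact/GIi|exact/GIi| |].
  by have /GIi := xy.
by have /GIi := yx.
Qed.

Lemma rel_class_closed y : closed (rel_class (GI psi) y).
Proof.
apply: closedI.
  apply: (@closed_preimage _ _ (fun z => (y, z)) (GI psi)); last exact: GI_closed.
  exact: pair_cts_r.
apply: (@closed_preimage _ _ (fun z => (z, y)) (GI psi)); last exact: GI_closed.
exact: pair_cts_l.
Qed.

(** A remainder point [p] of the class outside the closure [K] would have a neighbourhood [N] with
    [closure N] disjoint from [K]. The barrier is the boundary of the complement of [closure N],
    which contains [i x] but does not have [p] in its closure. *)
Lemma rel_class_closure x :
  rel_class (GI psi) (i x) = closure (i @` rel_class (GI phi) x).
Proof.
rewrite -rel_class_trace; set Eh := rel_class _ _.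
apply/seteqP; split=> [p Ep|]; last first.
  apply: subset_trans (rel_class_closed (y := i x)); apply: closureS.
  by move=> _ [a Ea <-].
have [[a _ ap]|np] := pselect (range i p).
  by apply: subset_closure; exists a => //; rewrite /= ap.
apply: contrapT; set K := closure _ => nKp.
have rY : {for p, @regular_space Y}.
  exact: (compact_regular hY cY filterT).
have [N pN NK] : filter_from (nbhs p) closure (~` K).
  apply: rY; apply: open_nbhs_nbhs; split => //.
  by apply: closed_openC; exact: closed_closure.
have Kix : K (i x).
  apply: subset_closure; exists x => //=.
  by apply: rel_class_refl; exact: GI_refl.
have [ixp pix] := Ep.
have [||c [[clc nc] ixc cp]] := GI_crosses_boundary cY hpsi
  (closed_openC (@closed_closure _ N)) ixp.
- by move=> /NK.
- move=> /(_ N pN)[z [nclz Nz]]; apply: nclz; exact: subset_closure.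
(* The crossing point [c] belongs to the class but not to [K], so it lies in the remainder and
   equals [p] by antisymmetry, although [p] is off the barrier. *)
have Kc : ~ K c.
  by move=> Kc; apply: nc => /NK.
have nc' : ~ range i c.
  move=> [a _ ac]; apply: Kc; rewrite -ac; apply: subset_closure; exists a => //=.
  by rewrite ac; split => //; exact: GI_trans cp pix.
have cpE : c = p.
  by apply: remainder_GI_antisym => //; exact: GI_trans pix ixc.
by move: clc; rewrite cpE => /(_ N pN)[z [nclz Nz]]; apply: nclz; exact: subset_closure.
Qed.

Lemma rel_class_eq y z : rel_class (GI psi) y z ->
  rel_class (GI psi) z = rel_class (GI psi) y.
Proof.
move=> [yz zy]; apply/seteqP; split=> w [a b]; split.
- exact: GI_trans yz a.
- exact: GI_trans b zy.
- exact: GI_trans zy a.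
- exact: GI_trans b yz.
Qed.

(** By antisymmetry a class has at most one remainder point. The cases are whether the class misses
    [X], meets both [X] and the remainder, or lies in [X]. In the mixed case a compact trace would
    be closed in [Y] and so equal to its closure, the whole class. *)
Lemma recurrent_class_trichotomy (Ehat : set Y) (E : set X) :
  is_rel_class (GJ psi) Ehat -> E = i @^-1` Ehat ->
  exactly_one_of_three
    (E = set0 /\ exists p, [/\ Ehat = [set p], ~ range i p & fixed_points psi p])
    [/\ is_rel_class (GJ phi) E, ~ compact E, closure (i @` E) = Ehat
      & exists2 p, Ehat `\` i @` E = [set p] & fixed_points psi p]
    [/\ Ehat = i @` E, compact E & is_rel_class (GJ phi) E].
Proof.
move=> [y yy ->] ->; rewrite rel_class_GJ //; set Eh := rel_class _ _.
have yEh : Eh y by apply: rel_class_refl; exact: GI_refl.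
have Ehd z : Eh z -> rel_diag (GJ psi) z by exact: rel_class_diag.
have Ehq z w : Eh z -> Eh w -> ~ range i z -> ~ range i w -> z = w.
  move=> [yz zy] [yw wy] nz nw; apply: remainder_GI_antisym => //.
    exact: GI_trans zy yw.
  exact: GI_trans wy yz.
have [[x Ex]|nE] := pselect (exists x, Eh (i x)); last first.
  have E0 : i @^-1` Eh = set0 by apply/seteqP; split => // x Ex; apply: nE; exists x.
  have nEr z : Eh z -> ~ range i z by move=> Ez [x _ xz]; apply: nE; exists x; rewrite xz.
  have nJ A : is_rel_class (GJ phi) A -> A <> set0.
    move=> [x xx AE] A0; have : A x by rewrite AE; exact: rel_class_refl.
    by rewrite A0.
  apply: Or31; split.
  - split => //; exists y; split; [|exact: nEr|].
      apply/seteqP; split=> [z Ez|_ ->//]; apply: (Ehq z y) => //; exact: nEr.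
    by apply: remainder_recurrent_fixed; split; [exact: nEr|].
  - by move=> [/nJ].
  - by move=> [_ _ /nJ].
have EhE : Eh = rel_class (GI psi) (i x) by rewrite (rel_class_eq Ex).
have xx : rel_diag (GJ phi) x by apply/GJi; exact: Ehd.
have EJ : is_rel_class (GJ phi) (i @^-1` Eh).
  by exists x => //; rewrite EhE rel_class_trace rel_class_GJ.
have n1 : ~ (i @^-1` Eh = set0 /\ exists p,
    [/\ Eh = [set p], ~ range i p & fixed_points psi p]).
  by move=> [E0 _]; have : (i @^-1` Eh) x by []; rewrite E0.
have clE : closure (i @` (i @^-1` Eh)) = Eh.
  by rewrite EhE rel_class_trace -rel_class_closure.
have closedEh : closed Eh by exact: rel_class_closed.
have cEh : compact Eh by apply: subclosed_compact cY _.
have [Er|nEr] := pselect (Eh `<=` range i).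
  have cE : compact (i @^-1` Eh) by exact: embedding_compact_preimage.
  apply: Or33; split => //; first by case.
  split => //; apply/seteqP; split=> [z Ez|_ [a Ea <-]//].
  by have [a _ az] := Er z Ez; exists a; rewrite //= az.
have [p [Ep np]] : exists p, Eh p /\ ~ range i p.
  by apply: contrapT => h; apply: nEr => z Ez; apply: contrapT => nz; apply: h; exists z.
have ncE : ~ compact (i @^-1` Eh).
  move=> cE; have : closed (i @` (i @^-1` Eh)).
    apply: (compact_closed hY); apply: continuous_compact => //.
    exact: continuous_subspaceT.
  move=> /closure_id; rewrite clE => h.
  by have : (i @` (i @^-1` Eh)) p; [rewrite h|move=> [a _ ap]; apply: np; exists a].
apply: Or32; split => //; last by case.
split => //; exists p; last by apply: remainder_recurrent_fixed; split => //; exact: Ehd.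
apply/seteqP; split=> [z [Ez nz]|_ ->]; last first.
  by split => // -[a _ ap]; apply: np; exists a.
apply: (Ehq z p) => // -[a _ az]; apply: nz; exists a => //=; by rewrite az.
Qed.

End LyapunovCompactification.

(** * Existence of the compactification *)

Lemma prod_topology_continuous (Z : topologicalType) (I : Type)
    (K : I -> topologicalType) (g : Z -> prod_topology K) :
  (forall j, continuous (fun z => g z j)) -> continuous g.
Proof.
move=> h z; apply/cvg_sup => j.
by apply: (@continuous_comp_initial _ _ _ (fun f : forall j, K j => f j) g); exact: h.
Qed.

Lemma prod_topology_proj_continuous (I : eqType) (K : I -> topologicalType) (j : I) :
  continuous (fun y : prod_topology K => y j).
Proof. exact: proj_continuous. Qed.

Lemma set_type_compact (T : topologicalType) (A : set T) :
  compact A -> compact [set: set_type A].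
Proof.
move=> cA F PF _.
have [|y [Ay cl]] := cA (set_val @ F) _.
  by rewrite /fmap /=; apply: filterE => z; exact: (set_valP z).
exists (exist _ y (mem_set Ay)); split => // B U FB.
rewrite nbhsE => -[W [[V oV VW] Wy] WU].
have [||_ [[z Bz <-] Vz]] := cl (set_val @` B) V.
- by move: (FB); rewrite /fmap /=; apply: filterS => z Bz /=; exists z.
- by apply: open_nbhs_nbhs; split => //; move: Wy; rewrite -VW.
- by exists z; split => //; apply: WU; rewrite -VW.
Qed.

Lemma set_type_hausdorff (T : topologicalType) (A : set T) :
  hausdorff_space T -> hausdorff_space (set_type A).
Proof.
move=> hT y z cl; apply: val_inj; apply: hT => U V yU zV.
have cv : continuous (set_val : set_type A -> T) by exact: initial_continuous.
have [w [Uw Vw]] := cl _ _ (cv y U yU) (cv z V zV).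
by exists (set_val w).
Qed.

Lemma set_type_continuous (Z T : topologicalType) (A : set T) (g : Z -> set_type A) :
  continuous (set_val \o g) -> continuous g.
Proof. by move=> cg; exact: (@continuous_comp_initial _ _ _ set_val g). Qed.

Section CompactlySupported.
Context {R : realType} {X : topologicalType} (phi : R -> X -> X).
Context (hX : lcsc_hausdorff X) (hphi : is_flow phi).

Lemma compactly_supported_bump (x : X) (U : set X) : open U -> U x ->
  exists f : X -> R, [/\ compactly_supported f, f x = 1 & forall y, ~ U y -> f y = 0].
Proof.
move=> oU Ux; have [lc _ hsX] := hX.
have [C xC cC] := locally_compact_nbhs x lc.
have clC : closed C by exact: compact_closed.
have oW : open (U `&` C°) by apply: openI => //; exact: open_interior.
have crX : completely_regular_space X.
  exact: (@locally_compact_completely_regular X R).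
have [|f [cf _ fx f0]] := completely_regular_separation R
  (x := x) (C := ~` (U `&` C°)) crX (open_closedC oW).
  by move=> /(_ (conj Ux xC)).
exists f; split => //; last by move=> y nU; apply: f0 => -[].
split => //; apply: (subclosed_compact (@closed_closure _ _) cC).
have -> : C = closure C by exact/closure_id.
apply: closureS => y /= fy; apply: interior_subset.
by apply: contrapT => nCy; move/eqP: fy; apply; apply: f0 => -[].
Qed.

Lemma compactly_supported_flow (f : X -> R) t :
  compactly_supported f -> compactly_supported (f \o phi t).
Proof.
move=> [cf cs]; split; first exact: (continuous_compose (flow_cts hphi t) cf).
pose P := phi t @^-1` closure [set x | f x != 0].
have cP : compact P.
  have -> : P = phi (- t) @` closure [set x | f x != 0].
    apply/seteqP; split=> [x Px|_ [y cy <-]].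
      by exists (phi t x) => //; rewrite (flowK hphi).
    by rewrite /P /= (flowNK hphi).
  apply: continuous_compact => //; apply: continuous_subspaceT.
  exact: (flow_cts hphi (- t)).
have clP : closed P.
  by apply: closed_preimage; [exact: (flow_cts hphi t)|exact: closed_closure].
apply: (subclosed_compact (@closed_closure _ _) cP).
have -> : P = closure P by exact/closure_id.
by apply: closureS => y /= fy; exact: subset_closure.
Qed.

(** The tube lemma over the support controls small times from points of the support. For two close
    times, either one of the two points is in the support and serves as starting point, or both
    values vanish. *)
Lemma compactly_supported_flow_unif (f : X -> R) :
  compactly_supported f -> flow_unif_continuous phi f.
Proof.
move=> [cf cs]; set K := closure _ in cs.
have f0 x : ~ K x -> f x = 0.
  by move=> nK; apply/eqP; apply/negPn/negP => fx; apply: nK; exact: subset_closure.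
apply/flow_unif_continuousP; split.
  apply/bounded_continuousP; split => //.
  have [M M0 h] := compact_set_bounded cs cf; exists M => x.
  have [/h//|/f0 ->] := pselect (K x); by rewrite normr0 ltW.
move=> e e0.
pose C : set (X * R) := [set p | `|f p.1 - f (phi p.2 p.1)| < e].
have C0 y : K y -> nbhs (y, 0) C.
  move=> _; apply: (@continuous_lt_nbhs _ _
    (fun p : X * R => `|f p.1 - f (phi p.2 p.1)|) (fun=> e)).
  - move=> p; apply: cvg_norm; apply: cvgB.
      exact: (continuous_compose (@fst_cts _ _) cf).
    apply: (continuous_compose _ cf).
    apply: (@continuous_compose _ _ _ (fun p : X * R => (p.2, p.1))
      (fun q : R * X => phi q.1 q.2)); last exact: flow_cts2.
    by apply: continuous_pair; [exact: snd_cts|exact: fst_cts].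
  - exact: cst_cts.
  - by rewrite /= (flow0 hphi) subrr normr0.
have /nbhs_ballP[d /= d0 hd] := compact_tube cs C0.
have bd (s t : R) : `|s - t| < d -> ball 0 d (s - t) by rewrite /ball /= sub0r normrN.
exists d => // s t x st.
have [Ks|nKs] := pselect (K (phi s x)).
  have := hd (t - s); rewrite distrC in st => /(_ (bd _ _ st) _ Ks).
  by rewrite /C /= -(flowD hphi) subrK.
have [Kt|nKt] := pselect (K (phi t x)).
  have := hd (s - t) (bd _ _ st) _ Kt.
  by rewrite /C /= -(flowD hphi) subrK distrC.
by rewrite !f0 // subrr normr0.
Qed.

End CompactlySupported.

(** * The compactification generated by an invariant family *)

Section Construction.
Context {R : realType} {X : topologicalType} (phi : R -> X -> X) (F : set (X -> R)).
Context (hX : lcsc_hausdorff X) (hphi : is_flow phi)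
  (uF : F `<=` flow_unif_continuous phi) (iF : forall t u, F u -> F (u \o phi t))
  (kF : compactly_supported `<=` F).

Let T := prod_topology (fun _ : X -> R => R).

(* Coordinates outside [F] are set to 0. *)
Let guard (u : X -> R) (r : R) : R := if `[< F u >] then r else 0.

Let eval (x : X) : T := fun u => guard u (u x).
Let shift (t : R) (y : T) : T := fun u => guard u (y (u \o phi t)).

Let A : set T := closure (range eval).
Let Y : topologicalType := set_type A.

Let guardE u r : F u -> guard u r = r.
Proof. by move=> Fu; rewrite /guard asboolT. Qed.

Let guardN u r : ~ F u -> guard u r = 0.
Proof. by move=> Fu; rewrite /guard asboolF. Qed.

Let bF u : F u -> exists M, forall x, `|u x| <= M.
Proof. by move=> /uF[/bounded_continuousP[]]. Qed.

Let cF u : F u -> continuous u.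
Proof. by move=> /uF[/bounded_continuousP[]]. Qed.

Let proj_cts u : continuous (fun y : T => y u).
Proof. exact: prod_topology_proj_continuous. Qed.

Let A_ind (C : set T) : closed C -> (forall x, C (eval x)) -> A `<=` C.
Proof.
move=> cC h; have -> : C = closure C by exact/closure_id.
by apply: closureS => _ [x _ <-]; exact: h.
Qed.

Let A0 y u : A y -> ~ F u -> y u = 0.
Proof.
move=> Ay nFu; apply: (A_ind (C := [set y : T | y u = 0]) _ _ Ay).
  apply: (@closed_preimage _ _ (fun y : T => y u) [set 0]); first exact: proj_cts.
  exact: closed_eq.
by move=> x /=; exact: guardN.
Qed.

Let eval_cts : continuous eval.
Proof.
apply: prod_topology_continuous => u; have [Fu|nFu] := pselect (F u).
  have -> : (fun z => eval z u) = u by apply/funext => z; exact: guardE.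
  exact: cF.
have -> : (fun z => eval z u) = fun=> 0 by apply/funext => z; exact: guardN.
exact: cst_cts.
Qed.

Let shift_cts t : continuous (shift t).
Proof.
apply: prod_topology_continuous => u; have [Fu|nFu] := pselect (F u).
  have -> : (fun z => shift t z u) = fun z => z (u \o phi t).
    by apply/funext => z; exact: guardE.
  exact: proj_cts.
have -> : (fun z => shift t z u) = fun=> 0 by apply/funext => z; exact: guardN.
exact: cst_cts.
Qed.

Let shift_eval t x : shift t (eval x) = eval (phi t x).
Proof.
apply/funext => u; rewrite /shift /eval; have [Fu|nFu] := pselect (F u).
  by rewrite !guardE //; exact: iF.
by rewrite !guardN.
Qed.

Let shift_A t y : A y -> A (shift t y).
Proof.
move=> Ay; apply: (A_ind (C := shift t @^-1` A) _ _ Ay).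
  by apply: closed_preimage; [exact: shift_cts|exact: closed_closure].
by move=> x; rewrite /= shift_eval; apply: subset_closure; exists (phi t x).
Qed.

Let A_compact : compact A.
Proof.
have exM u : exists M, F u -> forall x, `|u x| <= M.
  have [/bF[M h]|nF] := pselect (F u); first by exists M.
  by exists 0.
have [M hM] := choice exM.
(* The absolute value puts 0 into the segment also for [u] outside [F], where nothing is known about
   [M u]. *)
pose I u : set R := `[- `|M u|, `|M u|]%classic.
have cI : compact [set f : T | forall u, I u (f u)].
  by apply: (@tychonoff (X -> R) (fun=> R)) => u; exact: segment_compact.
apply: (subclosed_compact _ cI); first exact: closed_closure.
apply: A_ind.
  have -> : [set f : T | forall u, I u (f u)] =
      \bigcap_(u in [set: X -> R]) (fun f : T => f u) @^-1` I u.
    by apply/seteqP; split=> f h u => [_|]; exact: h.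
  apply: closed_bigI => u _; apply: closed_preimage; first exact: proj_cts.
  exact: interval_closed.
move=> x u; rewrite /I /= in_itv /= -ler_norml /eval.
have [Fu|nFu] := pselect (F u); last by rewrite guardN // normr0.
by rewrite guardE //; apply: le_trans (ler_norm _); exact: hM.
Qed.

Let i (x : X) : Y := exist _ (eval x) (mem_set (subset_closure (imageT eval x))).

Let psi (t : R) (y : Y) : Y :=
  exist _ (shift t (set_val y)) (mem_set (@shift_A t _ (set_valP y))).

Let val_cts : continuous (set_val : Y -> T).
Proof. exact: initial_continuous. Qed.

Let coord_cts u : continuous (fun y : Y => set_val y u).
Proof. exact: (continuous_compose val_cts (@proj_cts u)). Qed.

Let i_cts : continuous i.
Proof. by apply: set_type_continuous; exact: eval_cts. Qed.

Let coord_i u x : F u -> set_val (i x) u = u x.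
Proof. by move=> Fu; exact: guardE. Qed.

Let Y_compact : compact [set: Y].
Proof. exact: set_type_compact A_compact. Qed.

Let Y_hausdorff : hausdorff_space Y.
Proof.
apply: set_type_hausdorff; apply: (@hausdorff_product (X -> R) (fun=> R)) => _.
exact: Rhausdorff.
Qed.

Let Y_separated (y z : Y) : y <> z -> exists2 u, F u & set_val y u <> set_val z u.
Proof.
move=> yz; apply: contrapT => h; apply: yz; apply: val_inj; apply/funext => u.
have [Fu|nFu] := pselect (F u).
  by apply: contrapT => yzu; apply: h; exists u.
by rewrite (A0 (set_valP y) nFu) (A0 (set_valP z) nFu).
Qed.

(** Compactly supported bumps belong to [F]; they separate points of [X], and those vanishing off
    [U] have nonzero sets that cover exactly [U]. *)
Let i_embedding : topological_embedding i.
Proof.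
split.
  move=> x z xz; apply: contrapT => nxz; have [lc _ hsX] := hX.
  have oz : open (~` [set z]).
    by apply: closed_openC; apply: compact_closed => //; exact: compact_set1.
  have [f [kf fx f0]] := compactly_supported_bump (R := R) hX oz nxz.
  have : set_val (i x) f = set_val (i z) f by rewrite xz.
  rewrite !coord_i ?fx; [|exact: kF..]; rewrite f0; last by move=> /(_ erefl).
  by move/eqP; rewrite oner_eq0.
move=> U; split=> [oU|[V oV ->]]; last exact: open_preimage.
pose D := [set f : X -> R | compactly_supported f /\ forall x, ~ U x -> f x = 0].
exists (\bigcup_(f in D) (fun y : Y => set_val y f) @^-1` [set r | r != 0]).
  apply: bigcup_open => f _; apply: open_preimage; first exact: coord_cts.
  exact: open_neq.
apply/seteqP; split=> [x Ux|x [f [kf f0]]].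
  have [f [kf fx f0]] := compactly_supported_bump (R := R) hX oU Ux.
  by exists f => //=; rewrite coord_i ?fx ?oner_neq0 //; exact: kF.
rewrite /= coord_i; last exact: kF.
by apply: contraPP => nUx; apply/negP; rewrite negbK f0.
Qed.

Let i_dense : dense (range i).
Proof.
move=> O [y Oy] [V oV VO].
have [_ [[x _ <-] Vx]] : range eval `&` V !=set0.
  apply: (set_valP y); apply: open_nbhs_nbhs; split => //.
  by move: Oy; rewrite -VO.
by exists (i x); split; [rewrite -VO|exists x].
Qed.

Let i_compactification : proper_compactification i.
Proof. by split. Qed.

Let psi_flow : is_flow psi.
Proof.
split.
- apply: set_type_continuous; apply: prod_topology_continuous => u.
  have [Fu|nFu] := pselect (F u); last first.
    rewrite (_ : (fun _ => _) = fun=> 0); first exact: cst_cts.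
    by apply/funext => z; exact: guardN.
  rewrite (_ : (fun _ => _) = fun p : R * Y => set_val p.2 (u \o phi p.1)); last first.
    by apply/funext => p; exact: guardE.
  move=> -[t0 y0]; apply/cvgrPdist_lt => e e0; have e2 : 0 < e / 2 by rewrite divr_gt0.
  have /flow_unif_continuousP[_ /(_ _ e2)[d d0 hd]] := uF Fu.
  (* Uniform continuity along the flow bounds the effect of changing the time on the points of [X];
     the bound is a closed condition, so it holds on all of [Y]. Only the dependence on [y] at the
     fixed time [t0] is left, and that is continuity of a coordinate. *)
  have close (t : R) (y : Y) : `|t0 - t| < d ->
      `|set_val y (u \o phi t0) - set_val y (u \o phi t)| <= e / 2.
    move=> t0t; apply: (A_ind (C := [set y : T |
      `|y (u \o phi t0) - y (u \o phi t)| <= e / 2]) _ _ (set_valP y)).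
      apply: (@closed_preimage _ _ (fun y : T => `|y (u \o phi t0) - y (u \o phi t)|)
        [set r | r <= e / 2]); last exact: closed_le.
      exact: (continuous_normB (@proj_cts _) (@proj_cts _)).
    move=> x /=; rewrite /eval !guardE; [|exact: iF..].
    by apply/ltW/hd.
  have : \forall p \near (t0, y0), `|t0 - p.1| < d /\
      `|set_val y0 (u \o phi t0) - set_val p.2 (u \o phi t0)| < e / 2.
    exists ([set t | `|t0 - t| < d],
      [set y | `|set_val y0 (u \o phi t0) - set_val y (u \o phi t0)| < e / 2]).
      split => /=; first exact: (nbhsx_ballx t0 d d0).
      apply: (@continuous_lt_nbhs R Y (fun y =>
        `|set_val y0 (u \o phi t0) - set_val y (u \o phi t0)|) (fun=> e / 2)).
      - exact: (continuous_normB (@cst_cts _ _ _) (@coord_cts _)).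
      - exact: cst_cts.
      - by rewrite subrr normr0.
    by move=> [t y] [].
  apply: filterS => -[t y] [/= /(close t y) + +].
  rewrite !ler_distl !ltr_distl => /andP[? ?] /andP[? ?]; apply/andP; split; lra.
- move=> y; apply: val_inj; apply/funext => u.
  change (guard u (set_val y (u \o phi 0)) = set_val y u).
  have -> : u \o phi 0 = u by apply/funext => x; exact: (congr1 u (flow0 hphi x)).
  have [Fu|nFu] := pselect (F u); first exact: guardE.
  by rewrite guardN //; exact: esym (A0 (set_valP y) nFu).
- move=> s t y; apply: val_inj; apply/funext => u.
  change (guard u (set_val y (u \o phi (s + t))) =
    guard u (guard (u \o phi s) (set_val y ((u \o phi s) \o phi t)))).
  have [Fu|nFu] := pselect (F u); last by rewrite !guardN.
  rewrite !guardE //; last exact: iF.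
  congr (set_val y _); apply/funext => x; exact: (congr1 u (flowD hphi s t x)).
Qed.

Let psi_extension : flow_extension phi i psi.
Proof. by split => // t x; apply: val_inj => /=; exact: shift_eval. Qed.

(** For a closed subalgebra [C] containing [F], the continuous functions on [Y] with trace in [C]
    form a uniform algebra containing the coordinates, which separate points; Stone-Weierstrass
    makes it everything. *)
Let ext_algebra : extendable_functions i = smallest closed_subalgebra F.
Proof.
apply/seteqP; split; last first.
  apply: smallest_sub; first exact: extendable_closed_subalgebra.
  move=> u Fu; rewrite extendable_functionsE //.
  exists (fun y : Y => set_val y u); first exact: coord_cts.
  by apply/funext => x; exact: coord_i.
rewrite extendable_functionsE // => _ [v cv <-] C [hC FC].
have [C1 Cc CD CM /closed_uniformP Ccl] := hC.
pose B := [set v : Y -> R | continuous v /\ C (v \o i)].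
have [_ Kc KD KM Kcl] := uniform_algebra_continuous R Y.
suff BE : forall v : Y -> R, continuous v -> B v by case: (BE v cv).
apply: stone_weierstrass => //; first split.
- by move=> w [].
- by move=> c; split; [exact: Kc|exact: Cc].
- by move=> u w [cu Cu] [cw Cw]; split; [exact: KD|exact: CD].
- by move=> u w [cu Cu] [cw Cw]; split; [exact: KM|exact: CM].
- move=> u hu; split.
    by apply: Kcl => e /hu[w [cw _] uw]; exists w.
  apply: Ccl => e /hu[w [cw Cw] uw]; exists (w \o i) => // x; exact: uw.
- move=> y z /Y_separated[u Fu yzu]; exists (fun y : Y => set_val y u) => //.
  split; first exact: coord_cts.
  have -> : (fun y : Y => set_val y u) \o i = u by apply/funext => x; exact: coord_i.
  exact: FC.
Qed.

Lemma compactification_of_algebra : exists (Y : topologicalType) (i : X -> Y)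
    (psi : R -> Y -> Y),
  [/\ proper_compactification i, flow_extension phi i psi &
      extendable_functions i = smallest closed_subalgebra F].
Proof. by exists Y, i, psi. Qed.

End Construction.

Lemma lyapunov_compactification_exists (R : realType) (X : topologicalType)
    (phi : R -> X -> X) (L : set (X -> R)) :
  lcsc_hausdorff X -> is_flow phi -> sufficient phi L -> flow_invariant_family phi L ->
  exists (Y : topologicalType) (i : X -> Y) (psi : R -> Y -> Y),
    [/\ proper_compactification i, flow_extension phi i psi &
      extendable_functions i = smallest closed_subalgebra (L `|` compactly_supported)].
Proof.
move=> hX hphi [_ uL _] iL; apply: compactification_of_algebra => //.
- by move=> u [/uL//|]; exact: compactly_supported_flow_unif.
- move=> t u [Lu|ku]; last by right; exact: compactly_supported_flow.
  by left; rewrite -(iL t); exists u.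
Qed.

(** * Metrizability *)

(* A copy of [T] on which no topology is registered yet *)
Definition metric_carrier (T : choiceType) : Type := T.
HB.instance Definition _ (T : choiceType) := Choice.on (metric_carrier T).

Section MetricOfDistance.
Context (R : realType) (T : choiceType) (d : T -> T -> R).
Context (dxx : forall x, d x x = 0) (d0 : forall x y, d x y = 0 -> x = y)
  (dC : forall x y, d x y = d y x) (dD : forall y x z, d x z <= d x y + d y z).

Definition metric_of_distance : metricType R := HB.pack_for (metricType R)
  (metric_carrier T) (@isMetric.Build R (metric_carrier T) d dxx d0 dC dD).

Lemma metric_of_distance_ballE (x : metric_of_distance) e :
  ball x e = [set y | d x y < e].
Proof. by rewrite ballEmdist. Qed.

End MetricOfDistance.

(** * A compact space with countably many separating functions is metrizable *)

Section CountableSeparation.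
Context {R : realType} {Y : topologicalType} {J : countType} (g : J -> Y -> R).
Context (cY : compact [set: Y]) (cg : forall j, continuous (g j))
  (sep : forall y z, y <> z -> exists j, g j y <> g j z).

Let boundP j : exists M, 0 < M /\ forall y, `|g j y| <= M.
Proof. by have [M M0 h] := compact_continuous_bounded cY (cg (j := j)); exists M. Qed.

Let bound j : R := projT1 (cid (boundP j)).

Let bound_gt0 j : 0 < bound j.
Proof. by rewrite /bound; case: cid => M []. Qed.

Let boundE j y : `|g j y| <= bound j.
Proof. by rewrite /bound; case: cid => M [_ h] /=. Qed.

(** The weight makes the oscillation of [h j] at most the inverse of [(pickle j).+1], so only
    finitely many indices matter at a given scale and a supremum can serve as distance. *)
Let h j (y : Y) : R := g j y / (2 * bound j * (pickle j).+1%:R).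

Let weight_gt0 j : 0 < 2 * bound j * (pickle j).+1%:R.
Proof. by rewrite !mulr_gt0. Qed.

Let hE j y : `|h j y| <= 2^-1 * (pickle j).+1%:R^-1.
Proof.
rewrite /h normrM normfV (gtr0_norm (weight_gt0 j)) ler_pdivrMr //.
have -> : 2^-1 * (pickle j).+1%:R^-1 * (2 * bound j * (pickle j).+1%:R) = bound j.
  have k0 : (pickle j).+1%:R != 0 :> R by rewrite pnatr_eq0.
  by move: (pickle j).+1%:R k0 => k k0; field.
exact: boundE.
Qed.

Let hB j y z : `|h j y - h j z| <= (pickle j).+1%:R^-1.
Proof.
apply: le_trans (ler_normB _ _) _.
have := hE j y; have := hE j z; move: ((pickle j).+1%:R^-1) => w; lra.
Qed.

Let h_cts j : continuous (h j).
Proof.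
move=> y; apply: cvgM; [exact: cg|exact: cvg_cst].
Qed.

Let h_sep y z : y <> z -> exists j, h j y <> h j z.
Proof.
move=> /sep[j gj]; exists j => hj; apply: gj.
by move/(mulIf (invr_neq0 (lt0r_neq0 (weight_gt0 j)))): hj.
Qed.

(** The value 0 keeps the set nonempty when [J] is empty. *)
Let S y z : set R := [set r | r = 0 \/ exists j, r = `|h j y - h j z|].

Let dist y z : R := sup (S y z).

Let dist_ub y z : ubound (S y z) 1.
Proof.
move=> _ [->|[j ->]] //; apply: le_trans (hB j y z) _.
by rewrite invf_le1 // ler1n.
Qed.

Let dist_ge0 y z : 0 <= dist y z.
Proof. by apply: ub_le_sup; [exists 1|left]. Qed.

Let h_le_dist j y z : `|h j y - h j z| <= dist y z.
Proof. by apply: ub_le_sup; [exists 1|right; exists j]. Qed.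

Let dist_le y z c : 0 <= c -> (forall j, `|h j y - h j z| <= c) -> dist y z <= c.
Proof.
move=> c0 hc; apply: ge_sup; first by exists 0; left.
by move=> _ [->//|[j ->]].
Qed.

Let distxx y : dist y y = 0.
Proof.
apply/eqP; rewrite eq_le dist_ge0 andbT; apply: dist_le => // j.
by rewrite subrr normr0.
Qed.

Let dist_eq0 y z : dist y z = 0 -> y = z.
Proof.
move=> d0; apply: contrapT => /h_sep[j]; apply; apply/eqP.
by rewrite -subr_eq0 -normr_le0 -d0.
Qed.

Let distC y z : dist y z = dist z y.
Proof.
have le y' z' : dist y' z' <= dist z' y'.
  by apply: dist_le => // j; rewrite distrC.
by apply/eqP; rewrite eq_le !le.
Qed.

Let distD z y w : dist y w <= dist y z + dist z w.
Proof.
apply: dist_le => [|j]; first exact: addr_ge0.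
have := h_le_dist j y z; have := h_le_dist j z w.
have := ler_distD (h j z) (h j y) (h j w); lra.
Qed.

Let M := metric_of_distance distxx dist_eq0 distC distD.

(** Continuity handles the finitely many indices with small code; beyond [2 / e] the weights alone
    give the bound [e / 2]. *)
Let dist_nbhs y e : 0 < e -> nbhs y [set z | dist y z < e].
Proof.
move=> e0; have e2 : 0 < e / 2 by rewrite divr_gt0.
have near_small N : \forall z \near y, forall j, (pickle j < N)%N -> `|h j y - h j z| <= e / 2.
  elim: N => [|N IH]; first exact: nearW.
  suff : \forall z \near y, forall j, pickle j = N -> `|h j y - h j z| <= e / 2.
    move: IH; apply: filterS2 => z IH' hN j; rewrite ltnS leq_eqVlt => /orP[/eqP|].
      exact: hN.
    exact: IH'.
  have [[j jN]|nj] := pselect (exists j : J, pickle j = N); last first.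
    by apply: nearW => z j jN; exfalso; apply: nj; exists j.
  have /cvgrPdist_lt/(_ _ e2) : h j z @[z --> y] --> h j y by exact: h_cts.
  apply: filterS => z jz k kN; have -> : k = j by apply: (pcan_inj pickleK); rewrite kN.
  exact: ltW.
have := near_small (Num.truncn (2 / e)).+1.
apply: filterS => z small; apply: (@le_lt_trans _ _ (e / 2)); last by lra.
apply: dist_le => [|j]; first exact: ltW.
have [|jN] := ltnP (pickle j) (Num.truncn (2 / e)).+1; first exact: small.
apply: le_trans (hB j y z) _; rewrite -[e / 2]invf_div lef_pV2 ?posrE ?divr_gt0 //.
have h2 : 2 / e < (Num.truncn (2 / e)).+1%:R by exact: truncnS_gt.
by apply: ltW (lt_le_trans h2 _); rewrite ler_nat; exact: leqW.
Qed.

(** On the compact complement of [W] the distance to [y] has a positive lower bound: near each of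
    its points a single [h j] provides one. *)
Let dist_small y U : nbhs y U -> exists2 e, 0 < e & forall z, dist y z < e -> U z.
Proof.
rewrite nbhsE => -[W [oW Wy] WU].
have cW : compact (~` W).
  by rewrite -[~` W]setTI; apply: compact_closedI => //; exact: open_closedC.
have [e e0 he] : exists2 e, 0 < e & forall z, (~` W) z -> e <= dist y z.
  apply: (compact_induction
    (P := fun S => exists2 e, 0 < e & forall z, S z -> e <= dist y z) cW).
  - by exists 1.
  - by move=> A B AB [e e0 he]; exists e => // z /AB; exact: he.
  - move=> A B [e e0 he] [e' e0' he']; exists (Num.min e e').
      by rewrite lt_min e0.
    by move=> z [/he|/he']; rewrite ge_min => ->; rewrite ?orbT.
  - move=> z nWz; have [j hj] : exists j, h j y <> h j z.
      by apply: h_sep => yz; apply: nWz; rewrite -yz.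
    have d0 : 0 < `|h j y - h j z| by rewrite normr_gt0 subr_eq0; apply/eqP.
    exists [set w | `|h j y - h j z| / 2 < `|h j y - h j w|].
      apply: (@continuous_lt_nbhs R Y (fun=> `|h j y - h j z| / 2)
        (fun w => `|h j y - h j w|)).
      + exact: cst_cts.
      + exact: (continuous_normB (@cst_cts _ _ _) (@h_cts j)).
      + by lra.
    exists (`|h j y - h j z| / 2); first by rewrite divr_gt0.
    by move=> w /= /ltW hw; apply: le_trans hw (h_le_dist j y w).
exists e => // z yz; apply: WU; apply: contrapT => /he.
by rewrite leNgt yz.
Qed.

Lemma countable_separation_metrizable : metrizable R Y.
Proof.
exists M, (fun y : Y => y : M), (fun y : M => y : Y); split => //.
- move=> y U /nbhs_ballP[e /= e0 eU].
  apply: filterS (dist_nbhs y e0) => z /= yz.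
  by apply: eU; rewrite metric_of_distance_ballE.
- move=> y U /dist_small[e e0 eU].
  by apply/nbhs_ballP; exists e.
Qed.

End CountableSeparation.

Lemma countable_selection (T : Type) (A : set T) (J : Type) (Q : J -> T -> Prop) :
  A !=set0 -> exists a : J -> T, (forall j, A (a j)) /\
    forall j, (exists2 u, A u & Q j u) -> Q j (a j).
Proof.
move=> [a0 Aa0].
have ex j : exists a, A a /\ ((exists2 u, A u & Q j u) -> Q j a).
  have [[u Au Qu]|n] := pselect (exists2 u, A u & Q j u); first by exists u.
  by exists a0.
have [a ha] := choice ex.
by exists a; split => j; have [] := ha j.
Qed.

(** * Countable networks and countable selections *)

Section CountableNetwork.
Context {R : realType} {X : topologicalType}.
Context (hX : lcsc_hausdorff X) (mX : metrizable R X).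

(** Each compact piece [K n] is covered, for each [m], by countably many sets of diameter controlled
    by the inverse of [m.+1]. These need not be open: the uses below only ask for a set between a
    point and its neighbourhood. Two countable covers merge by interleaving indices. *)
Lemma countable_network : exists V : nat -> set X,
  forall x U, nbhs x U -> exists2 n, V n x & V n `<=` U.
Proof.
have [_ [K cK KT] _] := hX; have [M [f [g [cf cg fK gK]]]] := mX.
pose d x y : R := mdist (f x) (f y).
have dC x y : d x y = d y x by exact: metric_sym.
have dD x y z : d x z <= d x y + d y z by exact: metric_triangle.
have dnbhs x r : 0 < r -> nbhs x [set y | d x y < r].
  move=> r0; have : nbhs x (f @^-1` ball (f x) r) by apply: cf; exact: nbhsx_ballx.
  by apply: filterS => y; rewrite /= ballEmdist.
have dbase x U : nbhs x U -> exists2 r, 0 < r & forall y, d x y < r -> U y.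
  rewrite -{1}(fK x) => /cg /nbhs_ballP[r /= r0 rU]; exists r => // y xy.
  by rewrite -(fK y); apply: rU; rewrite ballEmdist.
pose small (r : R) (S : set X) := exists c : nat -> set X,
  S `<=` \bigcup_k c k /\ forall k x y, c k x -> c k y -> d x y < r.
have smallK r n : 0 < r -> small r (K n).
  move=> r0; apply: (compact_induction (P := small r) (cK n)).
  - by exists (fun=> set0); split.
  - by move=> A B AB [c [Bc hc]]; exists c; split => //; exact: subset_trans Bc.
  - move=> A B [c [Ac hc]] [c' [Bc' hc']].
    exists (fun k => if odd k then c k./2 else c' k./2); split; last first.
      by move=> k x y; case: (odd k); [exact: hc|exact: hc'].
    move=> x [/Ac[k _ ck]|/Bc'[k _ ck]].
      by exists k.*2.+1 => //=; rewrite odd_double /= uphalf_double.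
    by exists k.*2 => //=; rewrite odd_double doubleK.
  - move=> x _; have r2 : 0 < r / 2 by rewrite divr_gt0.
    exists [set y | d x y < r / 2]; first exact: dnbhs.
    exists (fun=> [set y | d x y < r / 2]); split; first by move=> y; exists 0%N.
    move=> _ y z /= xy xz; apply: le_lt_trans (dD y x z) _.
    by rewrite dC; lra.
have ex (mn : nat * nat) : exists c : nat -> set X, K mn.2 `<=` \bigcup_k c k /\
    forall k x y, c k x -> c k y -> d x y < mn.1.+1%:R^-1.
  by apply: smallK; rewrite invr_gt0.
have [c hc] := choice ex.
exists (fun j => if unpickle j is Some (m, n, k) then c (m, n) k else set0).
move=> x U /dbase[r r0 rU].
have [n _ Kx] : (\bigcup_n K n) x by rewrite KT.
pose m := Num.truncn r^-1.
have [/(_ _ Kx)[k _ ck] hd] := hc (m, n).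
exists (pickle (m, n, k)); rewrite pickleK // => y cy; apply: rU.
apply: lt_trans (hd _ _ _ ck cy) _ => /=.
by rewrite -[r]invrK ltf_pV2 ?posrE ?invr_gt0 // truncnS_gt.
Qed.

(** If [u y < u x], network sets around [x] and [y] inside the two sides of the midpoint value are
    strictly ordered by [u]. The function chosen for that pair of sets then orders [x] and [y] as
    well. *)
Lemma countable_order_separation (A : set (X -> R)) :
  A `<=` [set u | continuous u] -> A !=set0 ->
  exists a : nat * nat -> X -> R, (forall j, A (a j)) /\
    forall x y, (exists2 u, A u & u y < u x) -> exists j, a j y < a j x.
Proof.
move=> cA A0; have [V hV] := countable_network.
have [a [Aa ha]] := countable_selection (fun (j : nat * nat) (u : X -> R) =>
  forall x y, V j.1 x -> V j.2 y -> u y < u x) A0.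
exists a; split => // x y [u Au uyx]; have cu := cA u Au.
pose c := (u x + u y) / 2.
have [|m Vx VU] := hV x [set z | c < u z].
  by apply: continuous_lt_nbhs => //; [exact: cst_cts|rewrite /c; lra].
have [|n Vy VW] := hV y [set z | u z < c].
  by apply: continuous_lt_nbhs => //; [exact: cst_cts|rewrite /c; lra].
exists (m, n); apply: ha => //; exists u => // x' y' /= /VU h1 /VW h2.
exact: lt_trans h2 h1.
Qed.

End CountableNetwork.

Section MetrizableCompactification.
Context {R : realType} {X : topologicalType} (phi : R -> X -> X).
Context (hX : lcsc_hausdorff X) (hphi : is_flow phi) (mX : metrizable R X).

Lemma cst_lyapunov (c : R) : (lyapunov phi `&` flow_unif_continuous phi) (cst c).
Proof.
have bc : bounded_continuous (cst c : X -> R).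
  by apply/bounded_continuousP; split; [exact: cst_cts|exists `|c|].
split; first by split => // x s t _.
apply/flow_unif_continuousP; split => // e e0; exists 1 => // s t x _.
by rewrite subrr normr0.
Qed.

Lemma countable_sufficient : exists a : nat * nat -> X -> R, sufficient phi (range a).
Proof.
have cA : lyapunov phi `&` flow_unif_continuous phi `<=`
    [set u : X -> R | continuous u].
  by move=> u [[/bounded_continuousP[]]].
have [a [Aa ha]] := countable_order_separation hX mX cA
  (ex_intro _ _ (cst_lyapunov 0)).
exists a; split.
- by move=> _ [j _ <-]; case: (Aa j).
- by move=> _ [j _ <-]; case: (Aa j).
apply/seteqP; split=> [[x y] h|p Gp _ [j _ <-]]; last first.
  by apply: (lyapunov_GI hphi _ Gp); case: (Aa j).
apply: contrapT => /(lyapunov_separation hX hphi)[u [lu uu uyx]].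
have [|j] := ha x y; first by exists u.
rewrite ltNge => /negP; apply; apply: (h (a j)); by exists j.
Qed.

Lemma lyapunov_compactification_metrizable (Y : topologicalType) (i : X -> Y)
    (a : nat * nat -> X -> R) :
  proper_compactification i -> sufficient phi (range a) ->
  extendable_functions i = smallest closed_subalgebra
    ([set u \o phi t | u in range a & t in [set: R]] `|` compactly_supported) ->
  metrizable R Y.
Proof.
move=> hi [_ ua _] extE.
have cK : compactly_supported `<=` [set u : X -> R | continuous u] by move=> u [].
have k0 : compactly_supported (cst 0 : X -> R).
  split; first exact: cst_cts.
  have -> : [set x : X | cst 0 x != 0 :> R] = set0.
    by apply/seteqP; split => // x /=; rewrite eqxx.
  by rewrite closure0; exact: compact0.
have K0 : @compactly_supported R X !=set0 by exists (cst 0).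
have [b [Kb hb]] := countable_order_separation hX mX cK K0.
have [V hV] := countable_network hX mX.
have [c [Kc hc]] := countable_selection
  (fun n (u : X -> R) => forall x, V n x -> u x != 0) K0.
have bump x U : open U -> U x -> exists f : X -> R,
    [/\ compactly_supported f, f x = 1 & forall y, ~ U y -> f y = 0].
  exact: compactly_supported_bump.
have c_neq0 x : exists n, c n x != 0.
  have [f [kf fx _]] := bump x setT openT I.
  have [|n Vx VU] := hV x [set z | f z != 0].
    apply: open_nbhs_nbhs; split; last by rewrite /= fx oner_eq0.
    by have [cf _] := kf; exact: (open_preimage cf (@open_neq R 0)).
  by exists n; apply: hc => //; exists f => // z /VU.
have b_sep x y : x <> y -> exists j, b j x <> b j y.
  move=> xy; have [_ _ hsX] := hX.
  have oy : open (~` [set y]).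
    by apply: closed_openC; apply: compact_closed => //; exact: compact_set1.
  have [f [kf fx fy]] := bump x _ oy xy.
  have [|j bj] := hb x y.
    by exists f => //; rewrite fx fy // => /(_ erefl).
  by exists j => bxy; rewrite bxy ltxx in bj.
pose J := ((nat * nat * rat) + (nat * nat) + nat)%type.
pose U (j : J) : X -> R := match j with
  | inl (inl (m, q)) => a m \o phi (ratr q) | inl (inr m) => b m | inr n => c n end.
have extU j : exists v : Y -> R, continuous v /\ v \o i = U j.
  suff : extendable_functions i (U j).
    by rewrite extendable_functionsE // => -[v cv vU]; exists v.
  rewrite extE => C [_ subC]; apply: subC; case: j => [[[m q]|m]|n] /=.
  - by left; exists (a m); [exists m|exists (ratr q)].
  - by right; exact: Kb.
  - by right; exact: Kc.
have [g hg] := choice extU.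
apply: (@countable_separation_metrizable R Y J g (compactification_compact hi)).
  by move=> j; case: (hg j).
have gi j x : g j (i x) = U j x by case: (hg j) => _ <-.
have remainder n z : ~ range i z -> g (inr n) z = 0.
  move=> nz; have [cgn gU] := hg (inr n).
  have [w [cw wv w0]] := compactly_supported_extension hX hi (Kc n).
  by rewrite (compactification_eq hi cgn cw) ?w0 // gU wv.
move=> y z yz.
have [[x _ xy]|ny] := pselect (range i y); have [[x' _ xz]|nz] := pselect (range i z).
- have /b_sep[j bj] : x <> x' by move=> xx; apply: yz; rewrite -xy -xz xx.
  by exists (inl (inr j)); rewrite -xy -xz !gi.
- have [n cn] := c_neq0 x; exists (inr n); rewrite (remainder n z) // -xy gi.
  exact/eqP.
- have [n cn] := c_neq0 x'; exists (inr n); rewrite (remainder n y) // -xz gi.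
  by apply/nesym/eqP.
- have [v [cv [[_ [m _ <-] [t _ vE]]|kv] vyz]] := generator_separation hi extE yz.
    (* If [w] is uniformly within [e] of [v], equality of [w y] and [w z] would give
       [3 * e <= 2 * e]. *)
    pose e := `|v y - v z| / 3.
    have eE : `|v y - v z| = 3 * e by rewrite /e; lra.
    have e0 : 0 < e by rewrite divr_gt0 // normr_gt0 subr_eq0; apply/eqP.
    have [|_ /(_ e e0)[d d0 hd]] := (flow_unif_continuousP phi (a m)).1.
      by apply: ua; exists m.
    have td : t - d < t + d by lra.
    (* A rational [q] within [d] of [t] makes the translates of [a m] by these two times [e]-close
       on [X], and by density their extensions are [e]-close on [Y]. *)
    have [q] := rat_in_itvoo td; rewrite in_itv /= => /andP[q1 q2].
    exists (inl (inl (m, q))); set w := g _.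
    have [cw wE] := hg (inl (inl (m, q))).
    have wv y' : `|w y' - v y'| <= e.
      apply: (compactification_le hi (u := fun y => `|w y - v y|) (v := fun=> e)).
      - exact: continuous_normB.
      - exact: cst_cts.
      - move=> x; rewrite /w gi -[v (i x)]/((v \o i) x) -vE /=.
        by apply/ltW/hd; rewrite ltr_distl; apply/andP; split; lra.
    move=> wyz; have h1 := wv y; have h2 := wv z; rewrite wyz in h1.
    have := ler_distD (w z) (v y) (v z); rewrite (distrC (v y) (w z)) eE; lra.
  have [w [cw wv w0]] := compactly_supported_extension hX hi kv.
  by exfalso; apply: vyz; rewrite -(compactification_eq hi cw cv wv) !w0.
Qed.

End MetrizableCompactification.

Theorem theorem0p3 (R : realType) (X : topologicalType) (phi : R -> X -> X)
    (hX : lcsc_hausdorff X) (hphi : is_flow phi) :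
  (exists (Y : topologicalType) (i : X -> Y) (psi : R -> Y -> Y),
      lyapunov_compactification phi i /\ flow_extension phi i psi) /\
  (forall (Y : topologicalType) (i : X -> Y) (psi : R -> Y -> Y),
      lyapunov_compactification phi i -> flow_extension phi i psi ->
      [/\ (* (a) *)
          [/\ dynamic_compactification phi i psi,
              rel_trace i (GI psi) = GI phi
            & rel_trace i (GJ psi) = GJ phi],
          (* (b) *)
          [/\ compact (~` range i),
              forall t, psi t @` (~` range i) = ~` range i
            & ~` range i `&` rel_diag (GJ psi) `<=` fixed_points psi],
          (* (c) *)
          forall (Ehat : set Y) (E : set X),
            is_rel_class (GJ psi) Ehat -> E = i @^-1` Ehat ->
            exactly_one_of_three
              (* (i) *)
              (E = set0 /\
               exists p, [/\ Ehat = [set p], ~ range i p & fixed_points psi p])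
              (* (ii) *)
              [/\ is_rel_class (GJ phi) E, ~ compact E,
                  closure (i @` E) = Ehat
                & exists2 p, Ehat `\` i @` E = [set p] & fixed_points psi p]
              (* (iii) *)
              [/\ Ehat = i @` E, compact E & is_rel_class (GJ phi) E]
        & (* (d) *)
          forall x : X,
            rel_class (GI psi) (i x) = closure (i @` rel_class (GI phi) x)]) /\
  (* (e) *)
  (metrizable R X ->
    exists (Y : topologicalType) (i : X -> Y) (psi : R -> Y -> Y),
      [/\ lyapunov_compactification phi i, flow_extension phi i psi
        & metrizable R Y]).
Proof.
split; last split.
- have sL := sufficient_lyapunov hX hphi.
  have iL : flow_invariant_family phi (lyapunov phi `&` flow_unif_continuous phi).
    apply: (flow_invariant_familyP hphi) => t u [lu uu].
    by split; [exact: lyapunov_flow|exact: flow_unif_continuous_flow].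
  have [Y [i [psi [hi he extE]]]] := lyapunov_compactification_exists hX hphi sL iL.
  by exists Y, i, psi; split => //; split => //; eexists; split; [exact: sL|exact: iL|].
- move=> Y i psi [hi [L [sL _ extE]]] he; split.
  + have trJ := GJ_trace hX hphi hi he sL extE.
    have trI := GI_trace hi he sL extE.
    by split => //; split => //; exact: (flow_extension_compactification hphi hi he).
  + split.
    * exact: (compactification_remainder_compact hX hi).
    * exact: (remainder_invariant he).
    * exact: (remainder_recurrent_fixed hX hi he sL extE).
  + by move=> Ehat E; exact: (recurrent_class_trichotomy hX hphi hi he sL extE).
  + exact: (rel_class_closure hX hi he sL extE).
- move=> mX; have [a sa] := countable_sufficient hX hphi mX.
  have [sL iL] := sufficient_orbit hphi sa.
  have [Y [i [psi [hi he extE]]]] := lyapunov_compactification_exists hX hphi sL iL.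
  exists Y, i, psi; split => //.
    by split => //; eexists; split; [exact: sL|exact: iL|].
  exact: (lyapunov_compactification_metrizable hX mX hi sa extE).
Qed.
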